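(* Let $v$ be any integer. For integers $n\geq1$ with $n+v\geq0$ define $\Psi_n(v)$ by \[ 1+\frac{1!}{n}+\frac{2!}{n^2}+\cdots+\frac{(n+v-1)!}{n^{n+v-1}}+\frac{(n+v)!}{n^{n+v}}\Psi_n(v)=ne^{-n}\,\mathrm{Ei}(n). \] Then for every integer $R\geq1$, as $n\to\infty$, \[ \Psi_n(v)=\psi_0(v)+\frac{\psi_1(v)}{n}+\cdots+\frac{\psi_{R-1}(v)}{n^{R-1}}+O\!\left(\frac1{n^R}\right), \] with an implied constant depending only on $R$ and $v$, where \[ \psi_r(v)=\sum_{m=0}^{r}\tau_{r-m}(v)\sum_{k=0}^{m}(-1)^k\mathcal{A}_{m,k}\big(\gamma_1(v),\gamma_2(v),\dots\big). \]
   Context: $\mathrm{Ei}(n)=\lim_{\varepsilon\to0^+}\left(\int_{-\infty}^{-\varepsilon}\frac{e^t}{t}dt+\int_{\varepsilon}^{n}\frac{e^t}{t}dt\right)$. De Moivre polynomial $\mathcal{A}_{n,k}(a_1,a_2,\dots)$: coefficient of $x^n$ in $(a_1x+a_2x^2+\cdots)^k$ (so $\mathcal{A}_{0,0}=1$, $\mathcal{A}_{n,k}=0$ for $n<k$). Double factorial usual with $0!!=(-1)!!=1$; $\binom{v}{j}=v(v-1)\cdots(v-j+1)/j!$. Here $\gamma_r(v)=\sum_{m=0}^{2r}(-1)^m\binom{v}{2r-m}\sum_{k=0}^{m}\frac{(2r+2k-1)!!}{(-1)^k k!}\mathcal{A}_{m,k}(\frac13,\frac14,\frac15,\dots)$ and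 $\tau_r(v)=\sum_{m=0}^{2r+1}(-1)^{m+1}\binom{v}{2r+1-m}\sum_{k=0}^{m}\frac{(2r+2k-1)!!}{(-1)^k k!}\mathcal{A}_{m,k}(\frac13,\frac14,\frac15,\dots)$. *)

(* Defs.v *)
From Stdlib Require Import Reals ZArith.
From Coquelicot Require Import Coquelicot.
Open Scope R_scope.

Fixpoint rsum (n : nat) (f : nat -> R) : R :=
  match n with
  | O => 0
  | S m => rsum m f + f m
  end.

Definition Ei_integrand (t : R) : R := exp t / t.

Definition is_Ei (x L : R) : Prop :=
  exists I : R -> R,
    (forall eps, 0 < eps ->
       is_RInt_gen Ei_integrand (Rbar_locally m_infty) (at_point (- eps)) (I eps)) /\
    filterlim (fun eps => I eps + RInt Ei_integrand eps x) (at_right 0) (locally L).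

(* De Moivre polynomial A_{n,k}(a_1,a_2,...) = [x^n] (a_1 x + a_2 x^2 + ...)^k,
   computed by unfolding (sum_j a_j x^j)^(k+1) = (sum_j a_j x^j) * (...)^k;
   the sequence is a : nat -> R with a j = a_j (a 0 unused). *)
Fixpoint deMoivre (a : nat -> R) (n k : nat) : R :=
  match k with
  | O => if Nat.eqb n 0 then 1 else 0
  | S k' => rsum n (fun i => a (S i) * deMoivre a (n - S i)%nat k')
  end.

Fixpoint dfact (m : nat) : nat :=
  match m with
  | O => 1%nat
  | S O => 1%nat
  | S ((S p) as q) => (S q * dfact p)%nat
  end.

(* Double factorial on integers, with z!! = 1 for z <= 0 (so (-1)!! = 0!! = 1). *)
Definition dfactZ (z : Z) : R :=
  if Z.leb z 0 then 1 else INR (dfact (Z.to_nat z)).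

Fixpoint falling (v : R) (j : nat) : R :=
  match j with
  | O => 1
  | S i => falling v i * (v - INR i)
  end.

Definition gbinom (v : R) (j : nat) : R := falling v j / INR (fact j).

Definition a_seq (j : nat) : R := / INR (j + 2).

Definition inner_sum (r m : nat) : R :=
  rsum (S m) (fun k =>
    dfactZ (2 * Z.of_nat r + 2 * Z.of_nat k - 1)%Z / ((-1) ^ k * INR (fact k))
    * deMoivre a_seq m k).

Definition gamma_r (r : nat) (v : R) : R :=
  rsum (S (2 * r)) (fun m => (-1) ^ m * gbinom v (2 * r - m) * inner_sum r m).

Definition tau_r (r : nat) (v : R) : R :=
  rsum (S (2 * r + 1)) (fun m => (-1) ^ (S m) * gbinom v (2 * r + 1 - m) * inner_sum r m).

Definition psi_r (r : nat) (v : R) : R :=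
  rsum (S r) (fun m =>
    tau_r (r - m) v *
    rsum (S m) (fun k => (-1) ^ k * deMoivre (fun j => gamma_r j v) m k)).

(* Main.v *)
Require Import Defs.
From Stdlib Require Import Reals ZArith Lra Lia.
From Coquelicot Require Import Coquelicot.
Open Scope R_scope.

(** With [N = n + v] and [t = n (1 - s)], the geometric series gives
    [n e^(-n) Ei(n) = sum_(k < N) k! / n^k + n PV int_0^oo e^(-n s) s^N / (1 - s) ds],
    while [N! / n^N = n int_0^oo e^(-n s) s^N ds].  Hence [Psi_n] is the quotient of the
    integrals of [e^(n (1 - s)) s^N / (1 - s)^p] for [p = 1] and [p = 0].

    Both are treated by Laplace's method at [s = 1 + x]: the integrand is
    [e^(-n x^2 / 2) (1 + x)^v exp (n x^2 q(x))] with
    [q(x) = x / 3 - x^2 / 4 + ...]; expanding the last exponential and the powers of [q] gives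
    polynomials in [x], whose terms of the wrong parity cancel between [x] and [-x].  The
    principal value is therefore harmless, as the integral over [eps <= |x| <= 1/2] is
    controlled uniformly in [eps].  All estimates are relative to the truncated Gaussian
    integral over [eps, 1/2], to which the even moments reduce by parts up to exponentially
    small terms; it cancels in the quotient, which is a quotient of the
    series of the [tau_r] and the [gamma_r]. *)

(** * Finite sums *)

(** The limits that define the principal value and the integral to infinity are never interchanged
    with [n -> oo]. For each fixed [X = n], one cut [eps] and one upper end [S] are picked so that
    both cut integrals are within a prescribed tolerance of their limits; the Laplace estimates hold
    for all exponentially small [eps] and all [S >= 3/2], with constants free of both. The tolerance
    must be fixed before [eps] is known, so it rests on a lower bound of the Gaussian integral that
    does not involve [eps].

    The constants follow from a budget for the Gaussian. On [|x| <= 1/2] one has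
    [|q(x)| <= 2|x|/3 <= 1/3], so [exp (- X x^2 / 2)] outweighs [exp (X x^2 q(x))] by
    [exp (- X x^2 / 6)]. Part of this surplus pays for powers of [X x^2], and [exp (- X x^2 / 32)]
    is left, which is the original Gaussian stretched by 4. Since [x^(2n) = (X x^2)^n / X^n],
    cutting every expansion at [2n + p] terms gains [X^(-n)] and keeps a factor [|x|^p] that cancels
    the division by [(1 - s)^p]. *)

Lemma rsum_ext (n : nat) (f g : nat -> R) :
  (forall i, (i < n)%nat -> f i = g i) -> rsum n f = rsum n g.
Proof.
  induction n as [|n IH]; simpl; intros H; [easy|].
  rewrite IH by (intros; apply H; lia). now rewrite H by lia.
Qed.

Lemma rsum_plus (n : nat) (f g : nat -> R) :
  rsum n (fun i => f i + g i) = rsum n f + rsum n g.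
Proof. induction n as [|n IH]; simpl; [ring|rewrite IH; ring]. Qed.

Lemma rsum_scal (n : nat) (c : R) (f : nat -> R) :
  rsum n (fun i => c * f i) = c * rsum n f.
Proof. induction n as [|n IH]; simpl; [ring|rewrite IH; ring]. Qed.

Lemma rsum_minus (n : nat) (f g : nat -> R) :
  rsum n (fun i => f i - g i) = rsum n f - rsum n g.
Proof. induction n as [|n IH]; simpl; [ring|rewrite IH; ring]. Qed.

Lemma rsum_zero (n : nat) (f : nat -> R) :
  (forall i, (i < n)%nat -> f i = 0) -> rsum n f = 0.
Proof.
  induction n as [|n IH]; simpl; intros H; [easy|].
  rewrite IH by (intros; apply H; lia). rewrite H by lia. ring.
Qed.

Lemma rsum_recr (n : nat) (f : nat -> R) : rsum (S n) f = rsum n f + f n.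
Proof. reflexivity. Qed.

Lemma rsum_recl (n : nat) (f : nat -> R) :
  rsum (S n) f = f 0%nat + rsum n (fun i => f (S i)).
Proof.
  induction n as [|n IH]; [simpl; ring|].
  rewrite rsum_recr, IH. simpl. ring.
Qed.

Lemma rsum_exchange (n m : nat) (f : nat -> nat -> R) :
  rsum n (fun i => rsum m (fun j => f i j)) = rsum m (fun j => rsum n (fun i => f i j)).
Proof.
  induction n as [|n IH]; simpl.
  - now rewrite rsum_zero.
  - now rewrite IH, rsum_plus.
Qed.

Lemma rsum_le (n : nat) (f g : nat -> R) :
  (forall i, (i < n)%nat -> f i <= g i) -> rsum n f <= rsum n g.
Proof.
  induction n as [|n IH]; simpl; intros H; [lra|].
  apply Rplus_le_compat; [apply IH; intros|]; apply H; lia.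
Qed.

Lemma rsum_abs (n : nat) (f : nat -> R) :
  Rabs (rsum n f) <= rsum n (fun i => Rabs (f i)).
Proof.
  induction n as [|n IH]; simpl; [rewrite Rabs_R0; lra|].
  eapply Rle_trans; [apply Rabs_triang|lra].
Qed.

Lemma rsum_extend (n m : nat) (f : nat -> R) :
  (n <= m)%nat -> (forall i, (n <= i < m)%nat -> f i = 0) -> rsum m f = rsum n f.
Proof.
  intros Hnm; induction Hnm as [|m Hnm IH]; intros H; [easy|].
  simpl. rewrite IH by (intros; apply H; lia). rewrite H by lia. ring.
Qed.

Lemma rsum_double (n : nat) (f : nat -> R) :
  rsum (2 * n) f = rsum n (fun r => f (2 * r)%nat + f (2 * r + 1)%nat).
Proof.
  induction n as [|n IH]; [easy|].
  replace (2 * S n)%nat with (S (S (2 * n))) by lia.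
  rewrite !rsum_recr, IH. replace (2 * n + 1)%nat with (S (2 * n)) by lia. ring.
Qed.

(** * Taylor expansions on the punctured interval of radius 1/2 *)

Definition conv (a b : nat -> R) (n : nat) : R :=
  rsum (S n) (fun i => a i * b (n - i)%nat).

(** An explicit bound on a fixed interval, rather than a germ at 0, can be integrated against the
    Gaussian. The point 0 is left out because quotients by [x] have a junk value there. *)
Definition taylor_at (J : nat) (f : R -> R) (a : nat -> R) : Prop :=
  exists C, 0 <= C /\ forall x, 0 < Rabs x <= 1/2 ->
    Rabs (f x - rsum J (fun i => a i * x ^ i)) <= C * Rabs x ^ J.

Lemma taylor_at_ext (J : nat) (f g : R -> R) (a b : nat -> R) :
  (forall x, 0 < Rabs x <= 1/2 -> f x = g x) ->
  (forall i, (i < J)%nat -> a i = b i) ->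
  taylor_at J f a -> taylor_at J g b.
Proof.
  intros Hf Ha [C [HC H]]. exists C; split; [easy|]; intros x Hx.
  rewrite <- Hf by easy.
  rewrite <- (rsum_ext J (fun i => a i * x ^ i)) by (intros; now rewrite Ha).
  now apply H.
Qed.

Lemma taylor_at_poly (J : nat) (a : nat -> R) :
  taylor_at J (fun x => rsum J (fun i => a i * x ^ i)) a.
Proof.
  exists 0; split; [lra|]; intros x Hx. rewrite Rminus_diag, Rabs_R0. lra.
Qed.

Lemma taylor_at_pred (J : nat) (f : R -> R) (a : nat -> R) :
  taylor_at (S J) f a -> taylor_at J f a.
Proof.
  intros [C [HC H]]. exists (C + Rabs (a J)); split.
  { assert (h := Rabs_pos (a J)). lra. }
  intros x Hx. specialize (H x Hx). simpl in H.
  assert (HxJ : 0 <= Rabs x ^ J) by (apply pow_le; lra).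
  replace (f x - rsum J (fun i => a i * x ^ i))
    with ((f x - (rsum J (fun i => a i * x ^ i) + a J * x ^ J)) + a J * x ^ J) by ring.
  eapply Rle_trans; [apply Rabs_triang|].
  rewrite Rabs_mult, <- RPow_abs.
  assert (C * (Rabs x * Rabs x ^ J) <= C * (1 * Rabs x ^ J)).
  { apply Rmult_le_compat_l; [easy|]. apply Rmult_le_compat_r; lra. }
  lra.
Qed.

Lemma taylor_at_shift (J : nat) (f : R -> R) (a : nat -> R) :
  taylor_at (S J) f a -> taylor_at J (fun x => (f x - a 0%nat) / x) (fun i => a (S i)).
Proof.
  intros [C [HC H]]. exists C; split; [easy|]. intros x Hx.
  assert (Hx0 : x <> 0) by (intros ->; rewrite Rabs_R0 in Hx; lra).
  specialize (H x Hx). rewrite rsum_recl in H.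
  apply Rmult_le_reg_l with (Rabs x); [lra|].
  rewrite <- Rabs_mult.
  replace (x * ((f x - a 0%nat) / x - rsum J (fun i => a (S i) * x ^ i)))
    with (f x - (a 0%nat * x ^ 0 + rsum J (fun i => a (S i) * x ^ S i))).
  { simpl in H |- *. lra. }
  replace (rsum J (fun i => a (S i) * x ^ S i))
    with (x * rsum J (fun i => a (S i) * x ^ i)).
  { simpl. field. easy. }
  rewrite <- rsum_scal. apply rsum_ext; intros; simpl; ring.
Qed.

Lemma taylor_at_unshift (J : nat) (f : R -> R) (c : R) (a : nat -> R) :
  taylor_at J f a ->
  taylor_at (S J) (fun x => c + x * f x) (fun i => match i with O => c | S j => a j end).
Proof.
  intros [C [HC H]]. exists C; split; [easy|]. intros x Hx.
  rewrite rsum_recl.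
  replace (rsum J (fun i => a i * x ^ S i)) with (x * rsum J (fun i => a i * x ^ i))
    by (rewrite <- rsum_scal; apply rsum_ext; intros; simpl; ring).
  specialize (H x Hx).
  replace (c + x * f x - (c * x ^ 0 + x * rsum J (fun i => a i * x ^ i)))
    with (x * (f x - rsum J (fun i => a i * x ^ i))) by (simpl; ring).
  rewrite Rabs_mult. simpl.
  replace (C * (Rabs x * Rabs x ^ J)) with (Rabs x * (C * Rabs x ^ J)) by ring.
  apply Rmult_le_compat_l; [lra|easy].
Qed.

Lemma taylor_at_plus (J : nat) (f g : R -> R) (a b : nat -> R) :
  taylor_at J f a -> taylor_at J g b ->
  taylor_at J (fun x => f x + g x) (fun i => a i + b i).
Proof.
  intros [C [HC H]] [D [HD K]]. exists (C + D); split; [lra|]. intros x Hx.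
  specialize (H x Hx); specialize (K x Hx).
  replace (rsum J (fun i => (a i + b i) * x ^ i))
    with (rsum J (fun i => a i * x ^ i) + rsum J (fun i => b i * x ^ i))
    by (rewrite <- rsum_plus; apply rsum_ext; intros; ring).
  replace (f x + g x - (rsum J (fun i => a i * x ^ i) + rsum J (fun i => b i * x ^ i)))
    with ((f x - rsum J (fun i => a i * x ^ i)) + (g x - rsum J (fun i => b i * x ^ i)))
    by ring.
  eapply Rle_trans; [apply Rabs_triang|lra].
Qed.

Lemma taylor_at_scal (J : nat) (c : R) (f : R -> R) (a : nat -> R) :
  taylor_at J f a -> taylor_at J (fun x => c * f x) (fun i => c * a i).
Proof.
  intros [C [HC H]]. exists (Rabs c * C); split.
  { apply Rmult_le_pos; [apply Rabs_pos|easy]. }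
  intros x Hx. specialize (H x Hx).
  replace (rsum J (fun i => c * a i * x ^ i)) with (c * rsum J (fun i => a i * x ^ i))
    by (rewrite <- rsum_scal; apply rsum_ext; intros; ring).
  rewrite <- Rmult_minus_distr_l, Rabs_mult, Rmult_assoc.
  apply Rmult_le_compat_l; [apply Rabs_pos|easy].
Qed.

(* Induction on the order: [f = a_0 + x f_1] turns [f g] into [a_0 g + x (f_1 g)]. *)
Lemma taylor_at_mult (J : nat) (f g : R -> R) (a b : nat -> R) :
  taylor_at J f a -> taylor_at J g b ->
  taylor_at J (fun x => f x * g x) (conv a b).
Proof.
  revert f g a b. induction J as [|J IH]; intros f g a b Hf Hg.
  - destruct Hf as [C [HC H]], Hg as [D [HD K]].
    exists (C * D); split; [now apply Rmult_le_pos|]. intros x Hx.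
    specialize (H x Hx); specialize (K x Hx). simpl in *.
    rewrite Rminus_0_r in *. rewrite Rabs_mult, !Rmult_1_r in *.
    apply Rmult_le_compat; auto using Rabs_pos.
  - assert (H1 := taylor_at_unshift _ _ 0 _
                    (IH _ g _ b (taylor_at_shift _ _ _ Hf) (taylor_at_pred _ _ _ Hg))).
    assert (H2 := taylor_at_scal _ (a 0%nat) _ _ Hg).
    refine (taylor_at_ext _ _ _ _ _ _ _ (taylor_at_plus _ _ _ _ _ H2 H1)).
    + intros x Hx. simpl.
      assert (Hx0 : x <> 0) by (intros ->; rewrite Rabs_R0 in Hx; lra).
      field. easy.
    + intros i _. unfold conv. destruct i as [|i]; simpl.
      * ring.
      * change (rsum i (fun i0 : nat => a i0 * b match i0 with
                   | 0%nat => S i | S l => (i - l)%nat end) + a i * b match i with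
                   | 0%nat => S i | S l => (i - l)%nat end)
          with (rsum (S i) (fun i0 => a i0 * b (S i - i0)%nat)).
        rewrite rsum_recl. simpl.
        replace (i - i)%nat with 0%nat by lia. ring.
Qed.

(** The hypotheses on [c] say that the series of [f] is [- (a_1 y + a_2 y^2 + ...)] at [y = - x].
    Its [k]-th power contributes [(-1)^k] from the outer sign and [(-1)^m] from [y^m]. *)
Lemma taylor_at_pow (J : nat) (f : R -> R) (a c : nat -> R) (k : nat) :
  c 0%nat = 0 -> (forall j, c (S j) = - ((-1) ^ S j * a (S j))) ->
  taylor_at J f c ->
  taylor_at J (fun x => f x ^ k) (fun m => (-1) ^ (m + k) * deMoivre a m k).
Proof.
  intros Hc0 Hc Hf. induction k as [|k IH].
  - exists 1; split; [lra|]. intros x Hx. destruct J as [|J].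
    + simpl. rewrite Rminus_0_r, Rabs_R1. lra.
    + rewrite rsum_recl, rsum_zero by (intros; simpl; ring).
      simpl. rewrite Rmult_1_r, Rplus_0_r, Rmult_1_r, Rminus_diag, Rabs_R0.
      rewrite Rmult_1_l. apply Rmult_le_pos; [lra|apply pow_le; lra].
  - refine (taylor_at_ext _ _ _ _ _ _ _ (taylor_at_mult _ _ _ _ _ Hf IH)); [easy|].
    intros m _. unfold conv. rewrite rsum_recl, Hc0, Rmult_0_l, Rplus_0_l.
    change (deMoivre a m (S k))
      with (rsum m (fun i => a (S i) * deMoivre a (m - S i) k)).
    rewrite <- rsum_scal. apply rsum_ext; intros i Hi. rewrite Hc.
    replace (m + S k)%nat with (S (S i + (m - S i + k))) by lia.
    change ((-1) ^ S (S i + (m - S i + k))) with (-1 * (-1) ^ (S i + (m - S i + k))).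
    rewrite (pow_add (-1) (S i)). ring.
Qed.

Lemma deMoivre_lt (a : nat -> R) (k n : nat) : (n < k)%nat -> deMoivre a n k = 0.
Proof.
  revert n; induction k as [|k IH]; intros n Hn; [lia|]. simpl.
  apply rsum_zero; intros i Hi. rewrite IH by lia. ring.
Qed.

(* The geometric series [1 / (1 + y) = sum (-1)^k y^k] with [y = a_1 x + a_2 x^2 + ...]. *)
Lemma conv_geometric_inverse (a : nat -> R) (m : nat) :
  a 0%nat = 1 ->
  conv a (fun m => rsum (S m) (fun k => (-1) ^ k * deMoivre a m k)) m
  = if Nat.eqb m 0 then 1 else 0.
Proof.
  intros Ha. unfold conv. rewrite rsum_recl, Ha, Rmult_1_l, Nat.sub_0_r.
  destruct m as [|m]; [simpl; ring|].
  rewrite rsum_recl. simpl Nat.eqb. cbv iota.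
  replace (rsum (S m) (fun i => a (S i) *
     rsum (S (S m - S i)) (fun k => (-1) ^ k * deMoivre a (S m - S i) k)))
    with (rsum (S m) (fun k => (-1) ^ k * deMoivre a (S m) (S k))).
  - replace (rsum (S m) (fun i => (-1) ^ S i * deMoivre a (S m) (S i)))
      with (- 1 * rsum (S m) (fun k => (-1) ^ k * deMoivre a (S m) (S k)))
      by (rewrite <- rsum_scal; apply rsum_ext; intros; simpl; ring).
    simpl deMoivre. ring.
  (* All inner sums are stretched to the common length [S m], which only adds vanishing De Moivre
     polynomials; then the two sums can be exchanged. *)
  - rewrite (rsum_ext (S m) (fun i => a (S i) * _)
       (fun i => rsum (S m) (fun k => a (S i) * ((-1) ^ k * deMoivre a (S m - S i) k)))).
    + rewrite rsum_exchange. apply rsum_ext; intros k Hk.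
      change (deMoivre a (S m) (S k))
        with (rsum (S m) (fun i => a (S i) * deMoivre a (S m - S i) k)).
      rewrite <- rsum_scal. apply rsum_ext; intros i Hi. ring.
    + intros i Hi. rewrite rsum_scal. f_equal. symmetry. apply rsum_extend; [lia|].
      intros k Hk. rewrite deMoivre_lt by lia. ring.
Qed.

(** * Expansions of powers of [1 + x], of the logarithm and of the exponential *)

Lemma exp_le_mono (x y : R) : x <= y -> exp x <= exp y.
Proof. intros [H| ->]; [left; now apply exp_increasing|lra]. Qed.

(** The mean value point lies strictly between 0 and [x], so a bound on the derivative away from 0
    is enough; this matches the punctured interval of [taylor_at]. *)
Lemma mvt_bound (f df : R -> R) (x B : R) :
  (forall c, Rabs c <= Rabs x -> is_derive f c (df c)) ->
  (forall c, 0 < Rabs c <= Rabs x -> Rabs (df c) <= B) ->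
  Rabs (f x - f 0) <= B * Rabs x.
Proof.
  intros Hd HB.
  destruct (Rtotal_order x 0) as [Hx|[->|Hx]].
  - destruct (MVT_cor2 f df x 0) as [c [Hc1 Hc2]]; [easy| |].
    { intros c Hc. apply is_derive_Reals, Hd. rewrite !Rabs_left1; lra. }
    rewrite <- Rabs_Ropp, Ropp_minus_distr, Hc1, Rabs_mult.
    replace (0 - x) with (- x) by ring. rewrite Rabs_Ropp.
    apply Rmult_le_compat_r; [apply Rabs_pos|].
    apply HB. rewrite !Rabs_left1; lra.
  - rewrite Rminus_diag, Rabs_R0. lra.
  - destruct (MVT_cor2 f df 0 x) as [c [Hc1 Hc2]]; [easy| |].
    { intros c Hc. apply is_derive_Reals, Hd. rewrite !Rabs_right; lra. }
    rewrite Hc1, Rabs_mult, Rminus_0_r.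
    apply Rmult_le_compat_r; [apply Rabs_pos|].
    apply HB. rewrite !Rabs_right; lra.
Qed.

Lemma is_derive_rsum (n : nat) (f df : nat -> R -> R) (x : R) :
  (forall i, (i < n)%nat -> is_derive (f i) x (df i x)) ->
  is_derive (fun x => rsum n (fun i => f i x)) x (rsum n (fun i => df i x)).
Proof.
  induction n as [|n IH]; simpl; intros H.
  - apply (is_derive_const (K := R_AbsRing) (V := R_NormedModule)).
  - apply (is_derive_plus (K := R_AbsRing) (V := R_NormedModule)).
    + apply IH; intros; apply H; lia.
    + apply H; lia.
Qed.

Lemma taylor_at_antiderivative (J : nat) (f df : R -> R) (a : nat -> R) :
  (forall x, Rabs x <= 1/2 -> is_derive f x (df x)) ->
  taylor_at J df a ->
  taylor_at (S J) f
    (fun i => match i with O => f 0 | S j => a j / INR (S j) end).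
Proof.
  intros Hd [C [HC H]]. exists C; split; [easy|]. intros x Hx. rewrite rsum_recl.
  set (g := fun x => f x - rsum J (fun i => a i / INR (S i) * x ^ S i)).
  replace (f x - _) with (g x - g 0).
  2: { unfold g. rewrite (rsum_zero J (fun i => a i / INR (S i) * 0 ^ S i))
         by (intros; simpl; ring). simpl. ring. }
  replace (C * Rabs x ^ S J) with ((C * Rabs x ^ J) * Rabs x) by (simpl; ring).
  apply mvt_bound with (df := fun x => df x - rsum J (fun i => a i * x ^ i)).
  - intros c Hc. apply (is_derive_minus (K := R_AbsRing) (V := R_NormedModule)).
    + apply Hd. lra.
    + apply (is_derive_rsum J (fun i x => a i / INR (S i) * x ^ S i)
               (fun i x => a i * x ^ i)).
      intros i _. assert (Hi : INR (S i) <> 0) by (apply not_0_INR; lia).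
      auto_derive; [easy|].
      field. exact Hi.
  - intros c Hc. eapply Rle_trans; [apply H; lra|].
    apply Rmult_le_compat_l; [easy|]. apply pow_incr; lra.
Qed.

Lemma falling_S (v : R) (j : nat) : falling v (S j) = v * falling (v - 1) j.
Proof.
  induction j as [|j IH]; [simpl; ring|].
  change (falling v (S (S j))) with (falling v (S j) * (v - INR (S j))).
  rewrite IH, S_INR. simpl. ring.
Qed.

Lemma gbinom_S (v : R) (j : nat) : gbinom v (S j) = v * gbinom (v - 1) j / INR (S j).
Proof.
  unfold gbinom. rewrite falling_S.
  replace (INR (fact (S j))) with (INR (S j) * INR (fact j)) by (rewrite <- mult_INR; easy).
  field. split; [apply INR_fact_neq_0|apply not_0_INR; lia].
Qed.

Lemma gbinom_m1 (j : nat) : gbinom (-1) j = (-1) ^ j.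
Proof.
  unfold gbinom. induction j as [|j IH]; [simpl; field|].
  replace (INR (fact (S j))) with (INR (S j) * INR (fact j)) by (rewrite <- mult_INR; easy).
  simpl falling. rewrite <- tech_pow_Rmult, <- IH, S_INR. field.
  split; [apply INR_fact_neq_0|rewrite <- S_INR; apply not_0_INR; lia].
Qed.

Lemma ln_1p_bound (x : R) : Rabs x <= 1/2 -> Rabs (ln (1 + x)) <= 1.
Proof.
  intros Hx. apply Rabs_le_between in Hx.
  assert (H1 := exp_ineq1_le 1).
  apply Rabs_le. split.
  - rewrite <- (ln_exp (- (1))). apply ln_le; [apply exp_pos|].
    rewrite exp_Ropp. apply Rle_trans with (/ 2); [apply Rinv_le_contravar; lra|lra].
  - apply Rle_trans with (ln (exp 1)); [apply ln_le|rewrite ln_exp]; lra.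
Qed.

(** Induction on the order with [v] general: the derivative is [v] times the power of exponent
    [v - 1], whose expansion of one order less is integrated. *)
Lemma taylor_at_Rpower (J : nat) (v : R) :
  taylor_at J (fun x => Rpower (1 + x) v) (gbinom v).
Proof.
  revert v; induction J as [|J IH]; intros v.
  - exists (exp (Rabs v)); split; [left; apply exp_pos|]. intros x Hx. simpl.
    rewrite Rminus_0_r, Rmult_1_r. unfold Rpower.
    rewrite Rabs_pos_eq by (left; apply exp_pos).
    apply exp_le_mono.
    eapply Rle_trans; [apply Rle_abs|]. rewrite Rabs_mult.
    rewrite <- (Rmult_1_r (Rabs v)) at 2.
    apply Rmult_le_compat_l; [apply Rabs_pos|]. apply ln_1p_bound; lra.
  - assert (H : forall x, Rabs x <= 1/2 ->
        is_derive (fun x => Rpower (1 + x) v) x (v * Rpower (1 + x) (v - 1))).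
    { intros x Hx. apply Rabs_le_between in Hx. unfold Rpower. auto_derive; [lra|].
      replace ((v - 1) * ln (1 + x)) with (v * ln (1 + x) + - ln (1 + x)) by ring.
      rewrite exp_plus, exp_Ropp, exp_ln by lra. field. lra. }
    refine (taylor_at_ext _ _ _ _ _ _ _
      (taylor_at_antiderivative _ _ _ _ H (taylor_at_scal _ v _ _ (IH (v - 1)))));
      [easy|].
    intros i _. destruct i as [|i].
    + unfold gbinom, Rpower. simpl. rewrite Rplus_0_r, ln_1, Rmult_0_r, exp_0. field.
    + now rewrite gbinom_S.
Qed.

Lemma taylor_at_ln (J : nat) :
  taylor_at (S J) (fun x => ln (1 + x))
    (fun i => match i with O => 0 | S j => (-1) ^ j / INR (S j) end).
Proof.
  assert (H : forall x, Rabs x <= 1/2 ->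
      is_derive (fun x => ln (1 + x)) x (Rpower (1 + x) (-1))).
  { intros x Hx. apply Rabs_le_between in Hx. unfold Rpower. auto_derive; [lra|].
    replace (-1 * ln (1 + x)) with (- ln (1 + x)) by ring.
    rewrite exp_Ropp, exp_ln by lra. field. lra. }
  refine (taylor_at_ext _ _ _ _ _ _ _
    (taylor_at_antiderivative _ _ _ _ H (taylor_at_Rpower J (-1)))); [easy|].
  intros i _. destruct i as [|i].
  - now rewrite Rplus_0_r, ln_1.
  - now rewrite gbinom_m1.
Qed.

(* [ln (1 + x) = x - x^2 / 2 + x^2 * log_tail x]; the value at 0 is junk. *)
Definition log_tail (x : R) : R := (ln (1 + x) - x + x ^ 2 / 2) / x ^ 2.

(* [x^2 * log_tail x] has derivative [x^2 / (1 + x)], which lies between [0] and [2 x^2]. *)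
Lemma log_tail_bound (x : R) :
  0 < Rabs x <= 1/2 -> Rabs (log_tail x) <= 2/3 * Rabs x.
Proof.
  intros Hx.
  set (h := fun x => ln (1 + x) - x + x ^ 2 / 2).
  assert (Hh : forall c, -1/2 <= c -> derivable_pt_lim h c (c ^ 2 / (1 + c))).
  { intros c Hc. apply is_derive_Reals. unfold h. auto_derive; [lra|]. field. lra. }
  assert (Hk : forall c, -1/2 <= c ->
     derivable_pt_lim (fun x => h x - 2/3 * x ^ 3) c (c ^ 2 / (1 + c) - 2 * c ^ 2)).
  { intros c Hc. apply is_derive_Reals. unfold h. auto_derive; [lra|]. field. lra. }
  assert (Hb : forall c, -1/2 <= c -> 0 <= c ^ 2 / (1 + c) <= 2 * c ^ 2).
  { intros c Hc. assert (0 <= c ^ 2) by apply pow2_ge_0. split.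
    - apply Rmult_le_pos; [easy|]. left; apply Rinv_0_lt_compat; lra.
    - rewrite (Rmult_comm 2). apply Rmult_le_compat_l; [easy|].
      replace 2 with (/ (1/2)) by field. apply Rinv_le_contravar; lra. }
  assert (h0 : h 0 = 0) by (unfold h; rewrite Rplus_0_r, ln_1; field).
  assert (Habs : Rabs (h x) <= 2/3 * Rabs x ^ 3).
  { destruct (Rle_lt_dec 0 x) as [Hx0|Hx0].
    - rewrite (Rabs_pos_eq x) in * by easy.
      destruct (MVT_cor2 _ _ 0 x ltac:(lra) (fun c Hc => Hh c ltac:(lra))) as [c [E1 E1']].
      destruct (MVT_cor2 _ _ 0 x ltac:(lra) (fun c Hc => Hk c ltac:(lra))) as [d [E2 E2']].
      assert (B1 := Hb c ltac:(lra)). assert (B2 := Hb d ltac:(lra)).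
      rewrite h0 in *. rewrite Rabs_pos_eq by nra. nra.
    - rewrite (Rabs_left1 x) in * by lra.
      destruct (MVT_cor2 _ _ x 0 ltac:(lra) (fun c Hc => Hh c ltac:(lra))) as [c [E1 E1']].
      destruct (MVT_cor2 _ _ x 0 ltac:(lra) (fun c Hc => Hk c ltac:(lra))) as [d [E2 E2']].
      assert (B1 := Hb c ltac:(lra)). assert (B2 := Hb d ltac:(lra)).
      rewrite h0 in *. rewrite Rabs_left1 by nra. nra. }
  unfold log_tail, Rdiv. fold (h x).
  change (ln (1 + x) - x + x ^ 2 * / 2) with (h x).
  assert (H2 : 0 < Rabs x ^ 2) by (apply pow_lt; lra).
  rewrite Rabs_mult, Rabs_inv, <- RPow_abs.
  apply Rmult_le_reg_r with (Rabs x ^ 2); [easy|].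
  rewrite Rmult_assoc, Rinv_l, Rmult_1_r by lra.
  eapply Rle_trans; [exact Habs|]. simpl. lra.
Qed.

Lemma taylor_at_log_tail (J : nat) :
  taylor_at J log_tail
    (fun i => match i with O => 0 | S j => - ((-1) ^ S j * a_seq (S j)) end).
Proof.
  destruct J as [|J].
  { exists 1; split; [lra|]. intros x Hx. simpl. rewrite Rminus_0_r.
    assert (H := log_tail_bound x Hx). lra. }
  destruct (taylor_at_ln (S (S J))) as [C [HC H]]. exists C; split; [easy|].
  intros x Hx. specialize (H x Hx).
  assert (Hx0 : x <> 0) by (intros ->; rewrite Rabs_R0 in Hx; lra).
  rewrite (rsum_recl (S (S J))), (rsum_recl (S J)) in H.
  apply Rmult_le_reg_l with (Rabs x ^ 2); [apply pow_lt; lra|].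
  replace (Rabs x ^ 2 * (C * Rabs x ^ S J)) with (C * Rabs x ^ S (S (S J))) by (simpl; ring).
  eapply Rle_trans; [|exact H].
  rewrite RPow_abs, <- Rabs_mult. right. f_equal.
  (* The logarithm has the quadratic term [- x^2 / 2], while the constant coefficient of [log_tail]
     is 0. The summand [x^2 / 2] makes up for this, except in the empty sum, which is why order 0
     was treated separately. *)
  assert (HL : forall n,
    x ^ 2 * rsum n (fun i => match i with O => 0 | S j => - ((-1) ^ S j * a_seq (S j)) end
                     * x ^ i)
    = rsum n (fun i => (-1) ^ S i / INR (S (S i)) * x ^ S (S i))
      + (if Nat.eqb n 0 then 0 else x ^ 2 / 2)).
  { intros n. induction n as [|n IH]; [simpl; ring|].
    rewrite !rsum_recr, Rmult_plus_distr_l, IH. destruct n as [|n]; [simpl; field|].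
    unfold a_seq. replace (S n + 2)%nat with (S (S (S n))) by lia.
    simpl Nat.eqb. cbv iota. simpl pow. field. apply not_0_INR; lia. }
  rewrite Rmult_minus_distr_l, HL.
  set (L := rsum (S J) (fun i => (-1) ^ S i / INR (S (S i)) * x ^ S (S i))).
  match goal with |- _ = _ - (_ + (_ + ?r)) => change r with L end.
  clearbody L. unfold log_tail. simpl. field. lra.
Qed.

(** The remainder of order [S K] vanishes at 0 and its derivative is the remainder of order [K], so
    each use of the mean value theorem gains one factor [|z|]. *)
Lemma exp_remainder (K : nat) (z : R) :
  Rabs (exp z - rsum K (fun k => z ^ k / INR (fact k))) <= Rabs z ^ K * exp (Rabs z).
Proof.
  revert z; induction K as [|K IH]; intros z.
  - simpl. rewrite Rminus_0_r, Rmult_1_l, Rabs_pos_eq by (left; apply exp_pos).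
    apply exp_le_mono, Rle_abs.
  - set (g := fun z => exp z - rsum (S K) (fun k => z ^ k / INR (fact k))).
    assert (g0 : g 0 = 0).
    { unfold g. rewrite rsum_recl, rsum_zero.
      - rewrite exp_0. simpl. field.
      - intros i _. simpl pow. unfold Rdiv. ring. }
    change (Rabs (g z) <= Rabs z ^ S K * exp (Rabs z)).
    replace (g z) with (g z - g 0) by (rewrite g0; ring).
    replace (Rabs z ^ S K * exp (Rabs z)) with ((Rabs z ^ K * exp (Rabs z)) * Rabs z)
      by (simpl; ring).
    apply mvt_bound with (df := fun z => exp z - rsum K (fun k => z ^ k / INR (fact k))).
    + intros c _. apply (is_derive_minus (K := R_AbsRing) (V := R_NormedModule)).
      * apply is_derive_Reals, derivable_pt_lim_exp.
      * apply (is_derive_ext (fun z => 1 + rsum K (fun k => z ^ S k / INR (fact (S k))))).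
        { intros t. rewrite rsum_recl. simpl pow at 2. simpl (INR (fact 0)).
          unfold Rdiv at 2. rewrite Rinv_1, Rmult_1_r. easy. }
        replace (rsum K _) with (0 + rsum K (fun k => c ^ k / INR (fact k))) by ring.
        apply (is_derive_plus (K := R_AbsRing) (V := R_NormedModule)).
        { apply (is_derive_const (K := R_AbsRing) (V := R_NormedModule)). }
        apply (is_derive_rsum K (fun k z => z ^ S k / INR (fact (S k)))
                 (fun k z => z ^ k / INR (fact k))).
        intros k _. assert (Hk : INR (S k) <> 0) by (apply not_0_INR; lia).
        assert (Hf := INR_fact_neq_0 k).
        apply (is_derive_ext (fun z => / (INR (S k) * INR (fact k)) * z ^ S k)).
        { intros t. rewrite <- mult_INR.
          change (S k * fact k)%nat with (fact (S k)). unfold Rdiv. apply Rmult_comm. }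
        auto_derive; [easy|]. field. split; [easy|exact Hk].
    + intros c Hc. eapply Rle_trans; [apply IH|].
      apply Rmult_le_compat; [apply pow_le, Rabs_pos|left; apply exp_pos| |].
      * apply pow_incr; split; [apply Rabs_pos|easy].
      * now apply exp_le_mono.
Qed.

Lemma exp_mult_INR (n : nat) (x : R) : exp (INR n * x) = exp x ^ n.
Proof.
  induction n as [|n IH]; [simpl; now rewrite Rmult_0_l, exp_0|].
  rewrite S_INR. simpl. rewrite <- IH, <- exp_plus. f_equal. ring.
Qed.

(** This is the [j]-th power of [d y <= exp (d y)]. Taking [d = c / (j + 1)] instead of [c / j] also
    covers [j = 0]. *)
Lemma pow_le_exp (j : nat) (c : R) :
  0 < c -> exists C, 0 < C /\ forall y, 0 <= y -> y ^ j <= C * exp (c * y).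
Proof.
  intros Hc. set (d := c / INR (S j)).
  assert (HS : 0 < INR (S j)) by (apply lt_0_INR; lia).
  assert (Hd : 0 < d) by (now apply Rdiv_lt_0_compat).
  exists (/ d ^ j). assert (Hdj : 0 < d ^ j) by now apply pow_lt.
  split; [now apply Rinv_0_lt_compat|]. intros y Hy.
  apply Rmult_le_reg_l with (d ^ j); [easy|].
  rewrite <- Rmult_assoc, Rinv_r, Rmult_1_l, <- Rpow_mult_distr by lra.
  apply Rle_trans with (exp (d * y) ^ j).
  - apply pow_incr. assert (0 <= d * y) by (apply Rmult_le_pos; lra).
    assert (h := exp_ineq1_le (d * y)). lra.
  - rewrite <- exp_mult_INR. apply exp_le_mono.
    replace (c * y) with (INR (S j) * (d * y)) by (unfold d; field; lra).
    apply Rmult_le_compat_r; [apply Rmult_le_pos; lra|]. apply le_INR; lia.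
Qed.

(** Merges finitely many estimates, each with its own constant, into one that is uniform in the
    parameters [t], later pairs such as [(X, x)] or [(X, eps)]. *)
Lemma rsum_uniform_bound (T : Type) (D : T -> Prop) (f : nat -> T -> R) (g : T -> R) (n : nat) :
  (forall k, (k < n)%nat -> exists C, 0 <= C /\ forall t, D t -> f k t <= C * g t) ->
  exists C, 0 <= C /\ forall t, D t -> rsum n (fun k => f k t) <= C * g t.
Proof.
  induction n as [|n IH]; intros H.
  - exists 0; split; [lra|]. intros; simpl; lra.
  - destruct IH as [C [HC H1]]; [intros; apply H; lia|].
    destruct (H n) as [D' [HD' H2]]; [lia|].
    exists (C + D'); split; [lra|]. intros t Ht. simpl.
    specialize (H1 t Ht); specialize (H2 t Ht). lra.
Qed.

(** * Expansion of the integrand around its maximum *)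

(** The Taylor coefficients of [q(x)^k (1 + x)^v], where [q] is [log_tail]. *)
Definition bcoef (v : R) (k : nat) : nat -> R :=
  conv (fun m => (-1) ^ (m + k) * deMoivre a_seq m k) (gbinom v).

Lemma taylor_at_bcoef (v : R) (k J : nat) :
  taylor_at J (fun x => log_tail x ^ k * Rpower (1 + x) v) (bcoef v k).
Proof.
  apply taylor_at_mult; [|apply taylor_at_Rpower].
  refine (taylor_at_pow _ _ _ _ _ _ _ (taylor_at_log_tail J)); easy.
Qed.

Definition poly_approx (v : R) (K : nat) (X x : R) : R :=
  rsum K (fun k => X ^ k * x ^ (2 * k) / INR (fact k)
                   * rsum K (fun i => bcoef v k i * x ^ i)).

(** The rate [1/6] is the surplus [1/2 - 1/3] of the Gaussian over [exp (X x^2 q(x))], and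
    [1/32 = (1/2) / 4^2] suits the substitution in [wide_gaussian_le]; [13/96] is the difference of
    the two rates. *)
Lemma gaussian_absorb (j : nat) :
  exists C, 0 <= C /\ forall y, 0 <= y -> y ^ j * exp (- (y / 6)) <= C * exp (- (y / 32)).
Proof.
  destruct (pow_le_exp j (13/96)) as [C [HC H]]; [lra|].
  exists C; split; [lra|]. intros y Hy.
  replace (- (y / 32)) with (13 / 96 * y + - (y / 6)) by field.
  rewrite exp_plus, <- Rmult_assoc. apply Rmult_le_compat_r; [left; apply exp_pos|auto].
Qed.

Lemma inv_fact_le_1 (k : nat) : 0 < / INR (fact k) <= 1.
Proof.
  assert (H := lt_O_fact k). apply lt_INR in H. simpl in H.
  split; [now apply Rinv_0_lt_compat|].
  rewrite <- Rinv_1. apply Rinv_le_contravar; [lra|].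
  change 1 with (INR 1). apply le_INR. assert (h := lt_O_fact k). lia.
Qed.

(** The error has two sources: the Taylor remainders of the [K] terms [q^k (1 + x)^v], and the
    remainder of the exponential series. Each carries [|x|^K = |x|^p (x^2)^n]; writing [(x^2)^n] as
    [(X x^2)^n / X^n] leaves only powers of [X x^2], which the Gaussian absorbs. *)
Lemma expansion_error (v : R) (n p : nat) :
  exists C, 0 <= C /\ forall X x, 0 < X -> 0 < Rabs x <= 1/2 ->
    Rabs (exp (X * x ^ 2 * log_tail x) * Rpower (1 + x) v - poly_approx v (2 * n + p) X x)
      * exp (- (X * x ^ 2 / 2))
    <= C * (Rabs x ^ p / X ^ n * exp (- (X * x ^ 2 / 32))).
Proof.
  set (K := (2 * n + p)%nat).
  set (D := fun t : R * R => 0 < fst t /\ 0 < Rabs (snd t) <= 1/2).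
  set (T := fun k x => rsum K (fun i => bcoef v k i * x ^ i)).
  set (g := fun t : R * R => Rabs (snd t) ^ p / fst t ^ n * exp (- (fst t * snd t ^ 2 / 32))).
  set (f := fun k (t : R * R) => let (X, x) := t in
     Rabs (X ^ k * x ^ (2 * k) / INR (fact k)
           * (log_tail x ^ k * Rpower (1 + x) v - T k x)) * exp (- (X * x ^ 2 / 2))).
  assert (Hmono : forall y, 0 <= y -> exp (- (y / 2)) <= exp (- (y / 6)))
    by (intros; apply exp_le_mono; lra).
  assert (Hterm : forall k, (k < K)%nat ->
    exists C, 0 <= C /\ forall t, D t -> f k t <= C * g t).
  { intros k _. destruct (taylor_at_bcoef v k K) as [C [HC H]].
    destruct (gaussian_absorb (k + n)) as [B [HB H']].
    exists (C * B); split; [now apply Rmult_le_pos|].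
    intros [X x] [HX Hx]; unfold f, g; simpl fst in *; simpl snd in *.
    specialize (H x Hx). fold (T k x) in H.
    assert (Hy : 0 <= X * x ^ 2) by (apply Rmult_le_pos; [lra|apply pow2_ge_0]).
    specialize (H' _ Hy).
    assert (HXn : 0 < X ^ n) by now apply pow_lt.
    assert (Hxp : 0 <= Rabs x ^ p) by (apply pow_le; lra).
    rewrite Rabs_mult, pow_mult, <- Rpow_mult_distr.
    unfold Rdiv at 1. rewrite Rabs_mult.
    rewrite (Rabs_pos_eq ((X * x ^ 2) ^ k)) by now apply pow_le.
    destruct (inv_fact_le_1 k) as [F1 F2]. rewrite (Rabs_pos_eq (/ INR (fact k))) by lra.
    apply Rle_trans with ((X * x ^ 2) ^ k * 1 * (C * Rabs x ^ K) * exp (- (X * x ^ 2 / 6))).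
    { assert (0 <= (X * x ^ 2) ^ k) by now apply pow_le.
      apply Rmult_le_compat; [|left; apply exp_pos| |now apply Hmono].
      - apply Rmult_le_pos; [apply Rmult_le_pos; lra|apply Rabs_pos].
      - apply Rmult_le_compat; [apply Rmult_le_pos; lra|apply Rabs_pos| |easy].
        apply Rmult_le_compat_l; easy. }
    replace ((X * x ^ 2) ^ k * 1 * (C * Rabs x ^ K) * exp (- (X * x ^ 2 / 6)))
      with (C * (Rabs x ^ p / X ^ n) * ((X * x ^ 2) ^ (k + n) * exp (- (X * x ^ 2 / 6)))).
    - replace (C * B * (Rabs x ^ p / X ^ n * exp (- (X * x ^ 2 / 32))))
        with (C * (Rabs x ^ p / X ^ n) * (B * exp (- (X * x ^ 2 / 32)))) by ring.
      apply Rmult_le_compat_l; [|easy].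
      apply Rmult_le_pos; [easy|]. apply Rmult_le_pos; [easy|].
      left; now apply Rinv_0_lt_compat.
    - unfold K. rewrite (pow_add (X * x ^ 2)), (pow_add (Rabs x)), pow_mult, pow2_abs.
      rewrite (Rpow_mult_distr X (x ^ 2) n). field. lra. }
  (* Here [z = X x^2 q(x)] satisfies [|z| <= X x^2 |x|] and [|z| <= X x^2 / 3]: the first bound
     serves for [|z|^K], the second for [exp |z|]. The powers of [X x^2] then add up to
     [K + n = 3 n + p]. *)
  assert (Hrem : exists C, 0 <= C /\ forall t, D t ->
    let (X, x) := t in
    Rabs ((exp (X * x ^ 2 * log_tail x)
           - rsum K (fun k => (X * x ^ 2 * log_tail x) ^ k / INR (fact k)))
          * Rpower (1 + x) v) * exp (- (X * x ^ 2 / 2)) <= C * g t).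
  { destruct (taylor_at_Rpower 0 v) as [C [HC H]].
    destruct (gaussian_absorb (3 * n + p)) as [B [HB H']].
    exists (C * B); split; [now apply Rmult_le_pos|].
    intros [X x] [HX Hx]; unfold g; simpl fst in *; simpl snd in *.
    specialize (H x Hx). simpl rsum in H. rewrite Rminus_0_r, pow_O, Rmult_1_r in H.
    assert (Hy : 0 <= X * x ^ 2) by (apply Rmult_le_pos; [lra|apply pow2_ge_0]).
    specialize (H' _ Hy).
    assert (HXn : 0 < X ^ n) by now apply pow_lt.
    assert (Hxp : 0 <= Rabs x ^ p) by (apply pow_le; lra).
    assert (Hl := log_tail_bound x Hx).
    assert (Hz : Rabs (X * x ^ 2 * log_tail x) <= 2/3 * (X * x ^ 2 * Rabs x)).
    { rewrite Rabs_mult, (Rabs_pos_eq (X * x ^ 2)) by easy.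
      replace (2 / 3 * (X * x ^ 2 * Rabs x)) with ((X * x ^ 2) * (2 / 3 * Rabs x)) by ring.
      now apply Rmult_le_compat_l. }
    assert (Hyx : 0 <= X * x ^ 2 * Rabs x <= X * x ^ 2 * (1/2)).
    { split; [apply Rmult_le_pos; lra|apply Rmult_le_compat_l; lra]. }
    rewrite Rabs_mult.
    apply Rle_trans with
      (((X * x ^ 2 * Rabs x) ^ K * exp (X * x ^ 2 / 3)) * C * exp (- (X * x ^ 2 / 2))).
    { apply Rmult_le_compat_r; [left; apply exp_pos|].
      apply Rmult_le_compat; [apply Rabs_pos|apply Rabs_pos| |easy].
      eapply Rle_trans; [apply exp_remainder|].
      apply Rmult_le_compat; [apply pow_le, Rabs_pos|left; apply exp_pos| |].
      - apply pow_incr; split; [apply Rabs_pos|lra].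
      - apply exp_le_mono. lra. }
    replace ((X * x ^ 2 * Rabs x) ^ K * exp (X * x ^ 2 / 3) * C * exp (- (X * x ^ 2 / 2)))
      with (C * (Rabs x ^ p / X ^ n)
            * ((X * x ^ 2) ^ (3 * n + p) * exp (- (X * x ^ 2 / 6)))).
    - replace (C * B * (Rabs x ^ p / X ^ n * exp (- (X * x ^ 2 / 32))))
        with (C * (Rabs x ^ p / X ^ n) * (B * exp (- (X * x ^ 2 / 32)))) by ring.
      apply Rmult_le_compat_l; [|easy].
      apply Rmult_le_pos; [easy|]. apply Rmult_le_pos; [easy|].
      left; now apply Rinv_0_lt_compat.
    - replace (- (X * x ^ 2 / 6)) with (X * x ^ 2 / 3 + - (X * x ^ 2 / 2)) by field.
      rewrite exp_plus, (Rpow_mult_distr _ (Rabs x)).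
      replace (3 * n + p)%nat with (K + n)%nat by (unfold K; lia).
      rewrite (pow_add _ K n), (Rpow_mult_distr X (x ^ 2) n).
      replace (Rabs x ^ K) with ((x ^ 2) ^ n * Rabs x ^ p)
        by (unfold K; rewrite pow_add, pow_mult, pow2_abs; ring).
      field. lra. }
  destruct (rsum_uniform_bound _ D f g K Hterm) as [C1 [HC1 H1]].
  destruct Hrem as [C2 [HC2 H2]].
  exists (C1 + C2); split; [lra|]. intros X x HX Hx.
  specialize (H1 (X, x) (conj HX Hx)). specialize (H2 (X, x) (conj HX Hx)).
  cbv beta iota in H2. unfold g in H1, H2. simpl fst in *. simpl snd in *.
  rewrite Rmult_plus_distr_r.
  eapply Rle_trans; [|apply Rplus_le_compat; [exact H1|exact H2]].
  unfold f. rewrite (rsum_ext K _ (fun k => exp (- (X * x ^ 2 / 2)) *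
     Rabs (X ^ k * x ^ (2 * k) / INR (fact k)
           * (log_tail x ^ k * Rpower (1 + x) v - T k x)))) by (intros; apply Rmult_comm).
  rewrite rsum_scal, (Rmult_comm _ (rsum K _)), <- Rmult_plus_distr_r.
  apply Rmult_le_compat_r; [left; apply exp_pos|].
  eapply Rle_trans; [|apply Rplus_le_compat_r, rsum_abs].
  eapply Rle_trans; [|apply Rabs_triang]. right. f_equal.
  unfold poly_approx.
  rewrite (rsum_ext K (fun k => _ / _ * (_ - _)) (fun k =>
      Rpower (1 + x) v * ((X * x ^ 2 * log_tail x) ^ k / INR (fact k))
      - X ^ k * x ^ (2 * k) / INR (fact k) * T k x)).
  - rewrite rsum_minus, rsum_scal. unfold T. ring.
  - intros k _. rewrite pow_mult, !Rpow_mult_distr. unfold Rdiv. ring.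
Qed.

(** * Cancellation between [x] and [-x] *)

Lemma exp_nonpos_le_1 (x : R) : x <= 0 -> exp x <= 1.
Proof. intros H. rewrite <- exp_0. now apply exp_le_mono. Qed.

Lemma pow_le_1 (x : R) (n : nat) : 0 <= x <= 1 -> x ^ n <= 1.
Proof. intros H. rewrite <- (pow1 n). now apply pow_incr. Qed.

Lemma Rabs_pow_m1 (n : nat) : Rabs ((-1) ^ n) = 1.
Proof. rewrite <- RPow_abs, Rabs_left by lra. replace (- -1) with 1 by ring. apply pow1. Qed.

Lemma pow_opp_even (x : R) (r : nat) : (- x) ^ (2 * r) = x ^ (2 * r).
Proof. rewrite !pow_mult. f_equal. ring. Qed.

Lemma pow_opp_odd (x : R) (r : nat) : (- x) ^ (2 * r + 1) = - x ^ (2 * r + 1).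
Proof. rewrite !pow_add, pow_opp_even. simpl. ring. Qed.

(** Only the indices congruent to [p] modulo 2 survive, so a factor [x^p] splits off. For [p = 1]
    this removes the pole of the principal value. *)
Lemma rsum_parity (b : nat -> R) (n p : nat) (x : R) :
  (p < 2)%nat ->
  rsum (2 * n + p) (fun i => b i * (- x) ^ i)
  + (-1) ^ p * rsum (2 * n + p) (fun i => b i * x ^ i)
  = x ^ p * (2 * (-1) ^ p) * rsum n (fun r => b (2 * r + p)%nat * x ^ (2 * r)).
Proof.
  intros Hp. rewrite <- !rsum_scal, <- rsum_plus.
  destruct p as [|[|p]]; [| |lia].
  - rewrite Nat.add_0_r, rsum_double. apply rsum_ext; intros r _.
    rewrite pow_opp_even, pow_opp_odd, Nat.add_0_r. simpl pow. ring.
  - rewrite Nat.add_1_r, rsum_recl, rsum_double.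
    replace (b 0%nat * (- x) ^ 0 + (-1) ^ 1 * (b 0%nat * x ^ 0)) with 0 by (simpl; ring).
    rewrite Rplus_0_l. apply rsum_ext; intros r _.
    replace (S (2 * r)) with (2 * r + 1)%nat by lia.
    replace (S (2 * r + 1)) with (2 * S r)%nat by lia.
    rewrite pow_opp_even, pow_opp_odd, pow_add, !pow_1. ring.
Qed.

Lemma poly_approx_parity (v X x : R) (n p : nat) :
  (p < 2)%nat ->
  poly_approx v (2 * n + p) X (- x) + (-1) ^ p * poly_approx v (2 * n + p) X x
  = x ^ p * rsum (2 * n + p) (fun k => rsum n (fun r =>
      2 * (-1) ^ p * bcoef v k (2 * r + p) * X ^ k / INR (fact k) * x ^ (2 * (k + r)))).
Proof.
  intros Hp. unfold poly_approx. rewrite <- !rsum_scal, <- rsum_plus.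
  apply rsum_ext; intros k _. rewrite pow_opp_even.
  transitivity (X ^ k * x ^ (2 * k) / INR (fact k) *
    (rsum (2 * n + p) (fun i => bcoef v k i * (- x) ^ i)
     + (-1) ^ p * rsum (2 * n + p) (fun i => bcoef v k i * x ^ i))); [ring|].
  rewrite rsum_parity, <- !rsum_scal by easy. apply rsum_ext; intros r _.
  replace (2 * (k + r))%nat with (2 * k + 2 * r)%nat by lia.
  rewrite pow_add. unfold Rdiv. ring.
Qed.

(** * Truncated Gaussian moments *)

Definition moment (X eps : R) (j : nat) : R :=
  RInt (fun x => x ^ (2 * j) * exp (- (X * x ^ 2 / 2))) eps (1/2).

Lemma is_RInt_extR (f g : R -> R) (a b l : R) :
  (forall x, Rmin a b < x < Rmax a b -> f x = g x) -> is_RInt f a b l -> is_RInt g a b l.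
Proof. apply (is_RInt_ext (V := R_NormedModule)). Qed.

Lemma ex_RInt_derivable (f : R -> R) (a b : R) :
  (forall x, Rmin a b <= x <= Rmax a b -> ex_derive f x) -> ex_RInt f a b.
Proof.
  intros H. apply (ex_RInt_continuous (V := R_CompleteNormedModule)).
  intros z Hz. apply (ex_derive_continuous (K := R_AbsRing) (V := R_NormedModule)). auto.
Qed.

Lemma ex_RInt_gaussian (j : nat) (X c a b : R) :
  ex_RInt (fun x => x ^ j * exp (- (X * x ^ 2 / c))) a b.
Proof. apply ex_RInt_derivable. intros x _. auto_derive. easy. Qed.

Lemma is_RInt_moment (X eps : R) (j : nat) :
  is_RInt (fun x => x ^ (2 * j) * exp (- (X * x ^ 2 / 2))) eps (1/2) (moment X eps j).
Proof.
  apply (RInt_correct (V := R_CompleteNormedModule)), ex_RInt_gaussian.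
Qed.

(** Integration by parts: the derivative of [x^(2j+1) exp (- X x^2 / 2)] is integrated once through
    its primitive and once term by term. *)
Lemma moment_S (X eps : R) (j : nat) :
  0 < X ->
  moment X eps (S j) = INR (2 * j + 1) / X * moment X eps j
    + (eps ^ (2 * j + 1) * exp (- (X * eps ^ 2 / 2))
       - (1/2) ^ (2 * j + 1) * exp (- (X * (1/2) ^ 2 / 2))) / X.
Proof.
  intros HX.
  set (G := fun x => x ^ (2 * j + 1) * exp (- (X * x ^ 2 / 2))).
  assert (H1 : is_RInt (fun x => INR (2 * j + 1) * (x ^ (2 * j) * exp (- (X * x ^ 2 / 2)))
                 - X * (x ^ (2 * S j) * exp (- (X * x ^ 2 / 2)))) eps (1/2)
                 (G (1/2) - G eps)).
  { apply (is_RInt_derive (V := R_CompleteNormedModule)).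
    - intros x _. unfold G. auto_derive; [easy|].
      replace (Init.Nat.pred (j + (j + 0) + 1)) with (2 * j)%nat by lia.
      replace (j + (j + 0) + 1)%nat with (2 * j + 1)%nat by lia.
      replace (2 * S j)%nat with (2 * j + 1 + 1)%nat by lia.
      rewrite !(pow_add x). simpl (x ^ 1). simpl (x ^ 2). unfold Rdiv. field.
    - intros x _. apply (ex_derive_continuous (K := R_AbsRing) (V := R_NormedModule)).
      auto_derive. easy. }
  assert (H2 : is_RInt (fun x => INR (2 * j + 1) * (x ^ (2 * j) * exp (- (X * x ^ 2 / 2)))
                 - X * (x ^ (2 * S j) * exp (- (X * x ^ 2 / 2)))) eps (1/2)
                 (INR (2 * j + 1) * moment X eps j - X * moment X eps (S j))).
  { apply (is_RInt_minus (V := R_NormedModule));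
      apply (is_RInt_scal (V := R_NormedModule)); apply is_RInt_moment. }
  assert (E := is_RInt_unique (V := R_CompleteNormedModule) _ _ _ _ H1).
  rewrite (is_RInt_unique (V := R_CompleteNormedModule) _ _ _ _ H2) in E.
  unfold G in E.
  apply Rmult_eq_reg_l with X; [|lra].
  rewrite Rmult_plus_distr_l.
  replace (X * (INR (2 * j + 1) / X * moment X eps j))
    with (INR (2 * j + 1) * moment X eps j) by (field; lra).
  replace (X * ((eps ^ (2 * j + 1) * exp (- (X * eps ^ 2 / 2))
       - (1/2) ^ (2 * j + 1) * exp (- (X * (1/2) ^ 2 / 2))) / X))
    with (eps ^ (2 * j + 1) * exp (- (X * eps ^ 2 / 2))
       - (1/2) ^ (2 * j + 1) * exp (- (X * (1/2) ^ 2 / 2))) by (field; lra).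
  lra.
Qed.

Lemma dfact_SS (m : nat) : dfact (S (S m)) = (S (S m) * dfact m)%nat.
Proof. reflexivity. Qed.

Lemma dfactZ_odd_S (j : nat) :
  dfactZ (2 * Z.of_nat (S j) - 1) = INR (2 * j + 1) * dfactZ (2 * Z.of_nat j - 1).
Proof.
  (* The case [j = 0] is [1!! = 1 * (-1)!!] and uses the default value of [dfactZ]. *)
  unfold dfactZ. destruct j as [|j]; [simpl; ring|].
  replace (Z.leb (2 * Z.of_nat (S (S j)) - 1) 0) with false by (symmetry; apply Z.leb_gt; lia).
  replace (Z.leb (2 * Z.of_nat (S j) - 1) 0) with false by (symmetry; apply Z.leb_gt; lia).
  replace (Z.to_nat (2 * Z.of_nat (S (S j)) - 1)) with (S (S (2 * j + 1))) by lia.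
  replace (Z.to_nat (2 * Z.of_nat (S j) - 1)) with (2 * j + 1)%nat by lia.
  rewrite dfact_SS, mult_INR. f_equal. f_equal. lia.
Qed.

(* The cut [eps] is exponentially small, so that the boundary terms at [eps] and [1/2]
   are of the same order. *)
Definition small_cut (X eps : R) : Prop := 0 < eps <= exp (- (X / 8)) / (4 * X).

Lemma small_cut_bounds (X eps : R) :
  1 <= X -> small_cut X eps ->
  0 < eps /\ eps <= exp (- (X / 8)) / 4 /\ eps <= / (4 * X) /\ eps <= 1/4.
Proof.
  intros HX [H0 H]. assert (He := exp_pos (- (X / 8))).
  assert (He1 : exp (- (X / 8)) <= 1) by (apply exp_nonpos_le_1; lra).
  assert (HI : 0 < / (4 * X)) by (apply Rinv_0_lt_compat; lra).
  assert (HI4 : / (4 * X) <= / 4) by (apply Rinv_le_contravar; lra).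
  unfold Rdiv in *. repeat split; [easy| | |]; nra.
Qed.

(** The recursion is iterated down to [moment X eps 0]. The boundary term at 1/2 has the factor
    [exp (- X (1/2)^2 / 2) = exp (- X / 8)], and the one at [eps] is at most [eps], hence of the
    same order. *)
Lemma moment_asymptotic (j : nat) :
  exists C, 0 <= C /\ forall X eps, 1 <= X -> small_cut X eps ->
    Rabs (moment X eps j - dfactZ (2 * Z.of_nat j - 1) / X ^ j * moment X eps 0)
    <= C * exp (- (X / 8)).
Proof.
  induction j as [|j [C [HC IH]]].
  - exists 0; split; [lra|]. intros X eps HX He.
    replace (dfactZ (2 * Z.of_nat 0 - 1)) with 1 by reflexivity.
    replace (_ - _) with 0 by (simpl; field). rewrite Rabs_R0. lra.
  - exists (INR (2 * j + 1) * C + 2); split.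
    { assert (0 <= INR (2 * j + 1)) by apply pos_INR. nra. }
    intros X eps HX Hs. specialize (IH X eps HX Hs).
    destruct (small_cut_bounds X eps HX Hs) as [E0 [E1 [E2 E3]]].
    rewrite moment_S, dfactZ_odd_S by lra.
    set (B := (_ - _) / X).
    replace (INR (2 * j + 1) / X * moment X eps j + B
      - INR (2 * j + 1) * dfactZ (2 * Z.of_nat j - 1) / X ^ S j * moment X eps 0)
      with (INR (2 * j + 1) * / X *
        (moment X eps j - dfactZ (2 * Z.of_nat j - 1) / X ^ j * moment X eps 0) + B).
    2: { simpl pow. field. split; [apply pow_nonzero|]; lra. }
    eapply Rle_trans; [apply Rabs_triang|].
    rewrite Rmult_plus_distr_r. apply Rplus_le_compat.
    + rewrite Rabs_mult, Rmult_assoc.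
      assert (HI : 0 < / X <= 1).
      { split; [apply Rinv_0_lt_compat; lra|]. rewrite <- Rinv_1.
        apply Rinv_le_contravar; lra. }
      assert (HN := pos_INR (2 * j + 1)).
      rewrite Rabs_pos_eq by (apply Rmult_le_pos; lra).
      rewrite Rmult_assoc. apply Rmult_le_compat_l; [easy|].
      rewrite <- (Rmult_1_l (C * _)). apply Rmult_le_compat; [lra|apply Rabs_pos|lra|easy].
    + unfold B. replace (X * (1 / 2) ^ 2 / 2) with (X / 8) by field.
      assert (He := exp_pos (- (X / 8))).
      assert (P1 : 0 <= eps ^ (2 * j + 1) <= eps).
      { split; [apply pow_le; lra|]. replace (2 * j + 1)%nat with (S (2 * j)) by lia.
        simpl. rewrite <- (Rmult_1_r eps) at 3. apply Rmult_le_compat_l; [lra|].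
        apply pow_le_1; lra. }
      assert (P2 : 0 <= (1/2) ^ (2 * j + 1) <= 1).
      { split; [apply pow_le; lra|]. apply pow_le_1; lra. }
      assert (P3 : 0 < exp (- (X * eps ^ 2 / 2)) <= 1).
      { split; [apply exp_pos|]. apply exp_nonpos_le_1.
        assert (0 <= eps ^ 2) by apply pow2_ge_0. nra. }
      assert (HI : 0 < / X <= 1).
      { split; [apply Rinv_0_lt_compat; lra|]. rewrite <- Rinv_1.
        apply Rinv_le_contravar; lra. }
      unfold Rdiv at 1. rewrite Rabs_mult, (Rabs_pos_eq (/ X)) by lra.
      apply Rle_trans with ((2 * exp (- (X / 8))) * 1); [|lra].
      apply Rmult_le_compat; [apply Rabs_pos|lra| |lra].
      apply Rabs_le. split; nra.
Qed.

(** These bounds turn absolute errors into errors relative to the moment. The first is crude, the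
    true size being of order [X^(-1/2)], but any negative power of [X] dominates the exponentially
    small terms. *)
Lemma moment0_lower (X eps : R) :
  1 <= X -> small_cut X eps -> / (8 * X) <= moment X eps 0 /\ eps <= moment X eps 0.
Proof.
  intros HX Hs. destruct (small_cut_bounds X eps HX Hs) as [E0 [E1 [E2 E3]]].
  assert (HI : 0 < / X <= 1).
  { split; [apply Rinv_0_lt_compat; lra|]. rewrite <- Rinv_1. apply Rinv_le_contravar; lra. }
  rewrite Rinv_mult in E2.
  set (f := fun x => x ^ (2 * 0) * exp (- (X * x ^ 2 / 2))).
  assert (Hsub : forall a b c, eps <= a <= b -> b <= 1/2 ->
    (forall x, a <= x <= b -> c <= f x) -> c * (b - a) <= moment X eps 0).
  { intros a b c Ha Hb Hc.
    assert (Hf : forall y z, ex_RInt f y z) by (intros; apply ex_RInt_gaussian).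
    assert (Hpos : forall y z, y <= z -> 0 <= RInt f y z).
    { intros y z Hyz. apply RInt_ge_0; [easy|apply Hf|]. intros x _. unfold f.
      simpl pow. rewrite Rmult_1_l. left; apply exp_pos. }
    unfold moment. fold f.
    rewrite <- (RInt_Chasles f eps a (1/2)) by apply Hf.
    rewrite <- (RInt_Chasles f a b (1/2)) by apply Hf.
    assert (c * (b - a) <= RInt f a b).
    { replace (c * (b - a)) with (RInt (fun _ => c) a b)
        by (rewrite RInt_const; unfold scal; simpl; unfold mult; simpl; ring).
      apply RInt_le; [lra|apply ex_RInt_const|apply Hf|]. intros x Hx. apply Hc. lra. }
    assert (P1 := Hpos eps a ltac:(lra)). assert (P2 := Hpos b (1/2) ltac:(lra)).
    unfold plus; simpl. lra. }
  split.
  (* On [[1/(4X), 1/(2X)]], which lies above the cut, the exponent [X x^2 / 2] is at most [1/8], so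
     the integrand is at least [7/8]. *)
  - apply Rle_trans with (7/8 * (/ 2 * / X - / 4 * / X)).
    + rewrite Rinv_mult. lra.
    + apply Hsub; [lra|lra|]. intros x Hx. unfold f. simpl pow. rewrite Rmult_1_l.
      assert (H := exp_ineq1_le (- (X * (x * (x * 1)) / 2))).
      assert (x * x <= (/ 2 * / X) * (/ 2 * / X)) by (apply Rmult_le_compat; lra).
      assert (X * / X = 1) by (field; lra).
      assert (X * (x * x) <= X * ((/ 2 * / X) * (/ 2 * / X)))
        by (apply Rmult_le_compat_l; lra).
      replace (X * (/ 2 * / X * (/ 2 * / X))) with (/ 4 * / X) in * by (field; lra).
      lra.
  (* The integrand is at least [exp (- X / 8)] on the whole interval, whose length is at least
     [1/4]. *)
  - apply Rle_trans with (exp (- (X / 8)) * (1/2 - eps)).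
    + assert (He := exp_pos (- (X / 8))). nra.
    + apply Hsub; [lra|lra|]. intros x Hx. unfold f. simpl pow. rewrite Rmult_1_l.
      apply exp_le_mono. assert (x * x <= 1/2 * (1/2)) by (apply Rmult_le_compat; lra).
      nra.
Qed.

(* The substitution [x = 4 y]. *)
Lemma wide_gaussian_le (X eps : R) :
  1 <= X -> small_cut X eps ->
  RInt (fun x => exp (- (X * x ^ 2 / 32))) eps (1/2) <= 8 * moment X eps 0.
Proof.
  intros HX Hs. destruct (small_cut_bounds X eps HX Hs) as [E0 [E1 [E2 E3]]].
  destruct (moment0_lower X eps HX Hs) as [_ HM].
  set (f := fun x => x ^ (2 * 0) * exp (- (X * x ^ 2 / 2))).
  assert (Hf : forall y z, ex_RInt f y z) by (intros; apply ex_RInt_gaussian).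
  assert (Hf01 : forall x, 0 <= f x <= 1).
  { intros x. unfold f. simpl pow. rewrite Rmult_1_l. split; [left; apply exp_pos|].
    apply exp_nonpos_le_1. assert (0 <= x * x) by apply Rle_0_sqr. nra. }
  replace (RInt (fun x => exp (- (X * x ^ 2 / 32))) eps (1/2))
    with (4 * RInt f (eps / 4) (1/8)).
  (* The rescaled interval starts below the cut; the extra piece [[eps / 4, eps]] costs at most
     [eps], which the moment dominates. *)
  - assert (H : RInt f (eps / 4) (1/8) <= eps + moment X eps 0).
    { unfold moment. fold f.
      assert (C1 := RInt_Chasles f (eps / 4) (1/8) (1/2) (Hf _ _) (Hf _ _)).
      assert (C2 := RInt_Chasles f (eps / 4) eps (1/2) (Hf _ _) (Hf _ _)).
      unfold plus in C1, C2; simpl in C1, C2.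
      assert (0 <= RInt f (1/8) (1/2)).
      { apply RInt_ge_0; [lra|apply Hf|]. intros; apply Hf01. }
      assert (RInt f (eps / 4) eps <= 1 * (eps - eps / 4)).
      { replace (1 * (eps - eps / 4)) with (RInt (fun _ => 1) (eps / 4) eps)
          by (rewrite RInt_const; unfold scal; simpl; unfold mult; simpl; ring).
        apply RInt_le; [lra|apply Hf|apply ex_RInt_const|]. intros; apply Hf01. }
      lra. }
    lra.
  - assert (L := RInt_comp_lin (fun x => exp (- (X * x ^ 2 / 32))) 4 0 (eps / 4) (1/8)).
    replace (4 * (eps / 4) + 0) with eps in L by field.
    replace (4 * (1 / 8) + 0) with (1/2) in L by field.
    rewrite <- L.
    + rewrite <- (RInt_scal f) by apply Hf. apply RInt_ext. intros x _.
      unfold f, scal; simpl; unfold mult; simpl. rewrite Rmult_1_l. do 2 f_equal. field.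
    + apply ex_RInt_derivable. intros x _. auto_derive. easy.
Qed.

(** * Laplace expansion of the central part *)

(** The dependence on [n] is only apparent: [bcoef v k i] vanishes for [k > i], so for [r < n] the
    sum over [k] is already complete. *)
Definition laplace_coef (v : R) (p n r : nat) : R :=
  (-1) ^ p * rsum (2 * n + p) (fun k =>
    dfactZ (2 * Z.of_nat (k + r) - 1) / INR (fact k) * bcoef v k (2 * r + p)).

Lemma rsum_bcoef (v : R) (r i K : nat) :
  (i < K)%nat ->
  rsum K (fun k => dfactZ (2 * Z.of_nat (k + r) - 1) / INR (fact k) * bcoef v k i)
  = rsum (S i) (fun m => (-1) ^ m * gbinom v (i - m) * inner_sum r m).
Proof.
  intros HK. unfold bcoef, conv.
  rewrite (rsum_ext K _ (fun k => rsum (S i) (fun m =>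
     dfactZ (2 * Z.of_nat (k + r) - 1) / INR (fact k) *
     ((-1) ^ (m + k) * deMoivre a_seq m k * gbinom v (i - m)))))
    by (intros; now rewrite rsum_scal).
  rewrite rsum_exchange. apply rsum_ext; intros m Hm.
  unfold inner_sum. rewrite <- rsum_scal.
  rewrite (rsum_extend (S m) K) by
    (try lia; intros k Hk; rewrite deMoivre_lt by lia; ring).
  apply rsum_ext; intros k Hk.
  replace (2 * Z.of_nat r + 2 * Z.of_nat k - 1)%Z with (2 * Z.of_nat (k + r) - 1)%Z by lia.
  rewrite pow_add. unfold Rdiv. rewrite Rinv_mult, <- pow_inv.
  replace (/ -1) with (-1) by field. ring.
Qed.

Lemma laplace_coef_gamma (v : R) (n r : nat) :
  (r < n)%nat -> laplace_coef v 0 n r = gamma_r r v.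
Proof.
  intros Hr. unfold laplace_coef, gamma_r. rewrite rsum_bcoef, Nat.add_0_r by lia.
  simpl pow at 1. ring.
Qed.

Lemma laplace_coef_tau (v : R) (n r : nat) :
  (r < n)%nat -> laplace_coef v 1 n r = tau_r r v.
Proof.
  intros Hr. unfold laplace_coef, tau_r. rewrite rsum_bcoef, <- rsum_scal by lia.
  apply rsum_ext; intros m _. simpl pow. ring.
Qed.

Lemma is_RInt_rsum (n : nat) (f : nat -> R -> R) (l : nat -> R) (a b : R) :
  (forall i, is_RInt (f i) a b (l i)) ->
  is_RInt (fun x => rsum n (fun i => f i x)) a b (rsum n l).
Proof.
  intros H. induction n as [|n IH]; simpl.
  - assert (H0 := is_RInt_const (V := R_NormedModule) a b 0).
    unfold scal in H0; simpl in H0. unfold mult in H0; simpl in H0.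
    now rewrite Rmult_0_r in H0.
  - now apply (is_RInt_plus (V := R_NormedModule)).
Qed.

(* The exponentially small error of the moments beats every power of [X]. *)
Lemma moment_asymptotic_scaled (c : R) (n k j : nat) :
  exists C, 0 <= C /\ forall X eps, 1 <= X -> small_cut X eps ->
    Rabs (c * X ^ k
          * (moment X eps j - dfactZ (2 * Z.of_nat j - 1) / X ^ j * moment X eps 0))
    <= C * (moment X eps 0 / X ^ n).
Proof.
  destruct (moment_asymptotic j) as [C [HC H]].
  destruct (pow_le_exp (k + n + 1) (1/8)) as [D [HD H']]; [lra|].
  exists (Rabs c * C * (8 * D)); split.
  { repeat apply Rmult_le_pos; try lra. apply Rabs_pos. }
  intros X eps HX Hs. specialize (H X eps HX Hs). specialize (H' X ltac:(lra)).
  destruct (moment0_lower X eps HX Hs) as [HM _].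
  assert (Hk : 0 < X ^ k) by (apply pow_lt; lra).
  assert (Hn : 0 < X ^ n) by (apply pow_lt; lra).
  rewrite !Rabs_mult, (Rabs_pos_eq (X ^ k)) by lra.
  apply Rle_trans with (Rabs c * X ^ k * (C * exp (- (X / 8)))).
  { apply Rmult_le_compat_l; [|easy]. apply Rmult_le_pos; [apply Rabs_pos|lra]. }
  replace (Rabs c * X ^ k * (C * exp (- (X / 8))))
    with (Rabs c * C * (X ^ k * exp (- (X / 8)))) by ring.
  rewrite (Rmult_assoc (Rabs c * C)).
  apply Rmult_le_compat_l; [apply Rmult_le_pos; [apply Rabs_pos|easy]|].
  assert (E : exp (1/8 * X) * exp (- (X / 8)) = 1)
    by (rewrite <- exp_plus; replace (_ + _) with 0 by field; apply exp_0).
  apply Rle_trans with (8 * D * (/ (8 * X) / X ^ n)).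
  - apply Rmult_le_reg_r with (X ^ n * X); [apply Rmult_lt_0_compat; lra|].
    replace (8 * D * (/ (8 * X) / X ^ n) * (X ^ n * X))
      with (D * (exp (1/8 * X) * exp (- (X / 8)))) by (rewrite E; field; lra).
    replace (X ^ k * exp (- (X / 8)) * (X ^ n * X))
      with (X ^ (k + n + 1) * exp (- (X / 8))) by (rewrite !pow_add; simpl; ring).
    rewrite <- Rmult_assoc. apply Rmult_le_compat_r; [left; apply exp_pos|easy].
  - apply Rmult_le_compat_l; [lra|]. unfold Rdiv.
    apply Rmult_le_compat_r; [left; now apply Rinv_0_lt_compat|easy].
Qed.

(** The factor [X^k] from the exponential series meets [X^(-(k + r))] from the moment of order
    [k + r]. Hence every [k] contributes to the same power [X^(-r)], and the double sum is regrouped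
    by [r]. *)
Lemma rsum_moment_asymptotic (n K : nat) (c : nat -> nat -> R) :
  exists C, 0 <= C /\ forall X eps, 1 <= X -> small_cut X eps ->
    Rabs (rsum K (fun k => rsum n (fun r => c k r * X ^ k * moment X eps (k + r)))
          - moment X eps 0 * rsum n (fun r => rsum K (fun k =>
              c k r * dfactZ (2 * Z.of_nat (k + r) - 1)) / X ^ r))
    <= C * (moment X eps 0 / X ^ n).
Proof.
  set (D := fun t : R * R => 1 <= fst t /\ small_cut (fst t) (snd t)).
  set (g := fun t : R * R => moment (fst t) (snd t) 0 / fst t ^ n).
  destruct (rsum_uniform_bound (R * R) D (fun k t => rsum n (fun r =>
     Rabs (c k r * fst t ^ k * (moment (fst t) (snd t) (k + r)
       - dfactZ (2 * Z.of_nat (k + r) - 1) / fst t ^ (k + r) * moment (fst t) (snd t) 0))))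
     g K) as [C [HC H]].
  { intros k _. apply rsum_uniform_bound. intros r _.
    destruct (moment_asymptotic_scaled (c k r) n k (k + r)) as [C [HC H]].
    exists C; split; [easy|]. intros [X eps] [H1 H2]. now apply H. }
  exists C; split; [easy|]. intros X eps HX Hs.
  specialize (H (X, eps) (conj HX Hs)). unfold g in H. simpl fst in H. simpl snd in H.
  eapply Rle_trans; [|exact H].
  assert (E : moment X eps 0 * rsum n (fun r => rsum K (fun k =>
              c k r * dfactZ (2 * Z.of_nat (k + r) - 1)) / X ^ r)
    = rsum K (fun k => rsum n (fun r => c k r * X ^ k *
       (dfactZ (2 * Z.of_nat (k + r) - 1) / X ^ (k + r) * moment X eps 0)))).
  { rewrite rsum_exchange, <- rsum_scal. apply rsum_ext; intros r _.
    unfold Rdiv. rewrite (Rmult_comm (rsum K _)), <- Rmult_assoc, <- rsum_scal.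
    apply rsum_ext; intros k _. rewrite pow_add. field.
    split; apply pow_nonzero; lra. }
  rewrite E, <- rsum_minus.
  eapply Rle_trans; [apply rsum_abs|]. apply rsum_le; intros k _.
  rewrite <- rsum_minus.
  eapply Rle_trans; [|apply rsum_abs]. right. f_equal. apply rsum_ext; intros; ring.
Qed.

(** After folding [-x] onto [x], the factor [|x|^p] of [expansion_error] cancels the denominator
    [x^p]. The error is then bounded by a Gaussian without singularity, uniformly in [eps]. *)
Lemma central_asymptotic (v : R) (n p : nat) :
  (p < 2)%nat ->
  exists C, 0 <= C /\ forall X eps (f : R -> R), 1 <= X -> small_cut X eps ->
    (forall x, 0 < Rabs x <= 1/2 ->
       f x = exp (- (X * x ^ 2 / 2)) * (exp (X * x ^ 2 * log_tail x) * Rpower (1 + x) v)) ->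
    ex_RInt (fun x => (f (- x) + (-1) ^ p * f x) / x ^ p) eps (1/2) ->
    Rabs (RInt (fun x => (f (- x) + (-1) ^ p * f x) / x ^ p) eps (1/2)
          - 2 * moment X eps 0 * rsum n (fun r => laplace_coef v p n r / X ^ r))
    <= C * (moment X eps 0 / X ^ n).
Proof.
  intros Hp. set (K := (2 * n + p)%nat).
  set (c := fun k r => 2 * (-1) ^ p * bcoef v k (2 * r + p) / INR (fact k)).
  destruct (expansion_error v n p) as [C1 [HC1 H1]].
  destruct (rsum_moment_asymptotic n K c) as [C2 [HC2 H2]].
  (* The 16 is a factor 2 for the two points [x] and [-x], times the 8 of [wide_gaussian_le]. *)
  exists (16 * C1 + C2); split; [lra|]. intros X eps f HX Hs Hf Hex.
  specialize (H2 X eps HX Hs).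
  destruct (small_cut_bounds X eps HX Hs) as [E0 [E1 [E2 E3]]].
  assert (HXn : 0 < X ^ n) by (apply pow_lt; lra).
  replace (2 * moment X eps 0 * rsum n (fun r => laplace_coef v p n r / X ^ r))
    with (moment X eps 0 * rsum n (fun r => rsum K (fun k =>
              c k r * dfactZ (2 * Z.of_nat (k + r) - 1)) / X ^ r)).
  2: { rewrite (Rmult_comm 2), Rmult_assoc, <- (rsum_scal n 2). f_equal.
       apply rsum_ext; intros r _. unfold laplace_coef. fold K.
       rewrite <- rsum_scal. unfold Rdiv. rewrite <- Rmult_assoc, <- rsum_scal. f_equal.
       apply rsum_ext; intros k _. unfold c, Rdiv. ring. }
  set (S1 := rsum K (fun k => rsum n (fun r => c k r * X ^ k * moment X eps (k + r)))) in *.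
  set (P := fun x => rsum K (fun k => rsum n (fun r =>
      c k r * X ^ k * (x ^ (2 * (k + r)) * exp (- (X * x ^ 2 / 2)))))).
  assert (HP : is_RInt P eps (1/2) S1).
  { apply is_RInt_rsum. intros k.
    apply (is_RInt_rsum n (fun r x =>
      c k r * X ^ k * (x ^ (2 * (k + r)) * exp (- (X * x ^ 2 / 2))))).
    intros r. apply (is_RInt_scal (V := R_NormedModule)), is_RInt_moment. }
  set (g := fun x => (f (- x) + (-1) ^ p * f x) / x ^ p) in *.
  assert (Hgauss : ex_RInt (fun x => exp (- (X * x ^ 2 / 32))) eps (1/2))
    by (apply ex_RInt_derivable; intros; auto_derive; easy).
  assert (Hmain : Rabs (RInt g eps (1/2) - S1)
    <= (2 * C1 / X ^ n) * RInt (fun x => exp (- (X * x ^ 2 / 32))) eps (1/2)).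
  { refine (norm_RInt_le (V := R_NormedModule) (fun x => g x - P x)
      (fun x => (2 * C1 / X ^ n) * exp (- (X * x ^ 2 / 32))) eps (1/2) _ _ _ _ _ _).
    - lra.
    - intros x Hx. change (norm (g x - P x)) with (Rabs (g x - P x)).
      assert (Hx1 : 0 < Rabs x <= 1/2) by (rewrite Rabs_pos_eq; lra).
      assert (Hx2 : 0 < Rabs (- x) <= 1/2) by (now rewrite Rabs_Ropp).
      assert (B1 := H1 X x ltac:(lra) Hx1). assert (B2 := H1 X (- x) ltac:(lra) Hx2).
      fold K in B1, B2.
      rewrite Rabs_Ropp in B2.
      replace ((- x) ^ 2) with (x ^ 2) in B2 by ring.
      rewrite (Rabs_pos_eq x) in B1, B2 by lra.
      assert (Hxp : 0 < x ^ p) by (apply pow_lt; lra).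
      set (e := exp (- (X * x ^ 2 / 2))) in *.
      set (F1 := exp (X * x ^ 2 * log_tail x) * Rpower (1 + x) v) in *.
      set (F2 := exp (X * x ^ 2 * log_tail (- x)) * Rpower (1 + - x) v) in *.
      assert (He : 0 < e) by apply exp_pos.
      assert (Eg : g x - P x =
        ((F2 - poly_approx v K X (- x)) + (-1) ^ p * (F1 - poly_approx v K X x)) * e / x ^ p).
      { assert (EP : x ^ p * P x
          = e * (poly_approx v K X (- x) + (-1) ^ p * poly_approx v K X x)).
        { unfold K. rewrite poly_approx_parity by easy. fold K.
          rewrite <- Rmult_assoc, (Rmult_comm e), Rmult_assoc. f_equal.
          unfold P. rewrite <- rsum_scal. apply rsum_ext; intros k _.
          rewrite <- rsum_scal. apply rsum_ext; intros r _.
          fold e. unfold c, Rdiv. ring. }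
        apply Rmult_eq_reg_l with (x ^ p); [|lra].
        rewrite Rmult_minus_distr_l, EP. unfold g.
        rewrite (Hf x Hx1), (Hf (- x) Hx2).
        replace ((- x) ^ 2) with (x ^ 2) by ring. fold e F1 F2. field. lra. }
      rewrite Eg. unfold Rdiv.
      rewrite !Rabs_mult, (Rabs_pos_eq e), (Rabs_pos_eq (/ x ^ p))
        by (left; auto using Rinv_0_lt_compat).
      apply Rmult_le_reg_r with (x ^ p); [easy|].
      rewrite (Rmult_assoc _ (/ x ^ p)), Rinv_l, Rmult_1_r by lra.
      apply Rle_trans with
        ((Rabs (F2 - poly_approx v K X (- x)) + Rabs (F1 - poly_approx v K X x)) * e).
      + apply Rmult_le_compat_r; [lra|]. eapply Rle_trans; [apply Rabs_triang|].
        rewrite (Rabs_mult ((-1) ^ p)), Rabs_pow_m1. lra.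
      + unfold Rdiv in *. lra.
    - apply (is_RInt_minus (V := R_NormedModule)); [|easy].
      now apply (RInt_correct (V := R_CompleteNormedModule)).
    - apply (is_RInt_scal (V := R_NormedModule)).
      now apply (RInt_correct (V := R_CompleteNormedModule)). }
  assert (HW := wide_gaussian_le X eps HX Hs).
  match goal with |- Rabs (?a - ?b) <= _ =>
    replace (a - b) with ((a - S1) + (S1 - b)) by ring end.
  eapply Rle_trans; [apply Rabs_triang|].
  rewrite Rmult_plus_distr_r. apply Rplus_le_compat; [|exact H2].
  eapply Rle_trans; [exact Hmain|].
  replace (16 * C1 * (moment X eps 0 / X ^ n))
    with ((2 * C1 / X ^ n) * (8 * moment X eps 0)) by (field; lra).
  apply Rmult_le_compat_l; [|easy].
  apply Rmult_le_pos; [lra|]. left; now apply Rinv_0_lt_compat.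
Qed.

(** * Tails of the integrand *)

(** The factor [exp X] normalises the value at [s = 1] to 1. *)
Definition weight (X : R) (N : nat) (s : R) : R := exp (X * (1 - s)) * s ^ N.

Lemma weight_pos (X : R) (N : nat) (s : R) : 0 <= s -> 0 <= weight X N s.
Proof. intros Hs. apply Rmult_le_pos; [left; apply exp_pos|now apply pow_le]. Qed.

Lemma weight_left (X v : R) (N : nat) (s : R) :
  INR N = X + v -> 0 <= s <= 1/2 ->
  weight X N s <= exp (2 * Rabs v) * exp (- (X / 10)).
Proof.
  intros HN Hs. unfold weight.
  (* A strict gain over [s <= exp (- (1 - s))], available away from [s = 1]; its [N]-th power yields
     [exp (- X / 10)]. It reduces to [s <= 9/10 ((1 + s) / 2)^2] on [[0, 1/2]]. *)
  assert (H1 : s <= exp (- (1/10) - (1 - s))).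
  { unfold Rminus at 1. rewrite exp_plus.
    assert (A := exp_ineq1_le (- (1/10))).
    replace (- (1 - s)) with (- ((1 - s) / 2) + - ((1 - s) / 2)) by field.
    rewrite exp_plus. assert (B := exp_ineq1_le (- ((1 - s) / 2))).
    set (e := exp (- ((1 - s) / 2))) in *.
    assert ((1 - (1 - s) / 2) * (1 - (1 - s) / 2) <= e * e)
      by (apply Rmult_le_compat; lra).
    assert ((9/10) * ((1 - (1 - s) / 2) * (1 - (1 - s) / 2)) <= exp (- (1/10)) * (e * e))
      by (apply Rmult_le_compat; nra).
    nra. }
  apply Rle_trans with (exp (X * (1 - s)) * exp (- (1/10) - (1 - s)) ^ N).
  { apply Rmult_le_compat_l; [left; apply exp_pos|]. apply pow_incr; lra. }
  rewrite <- exp_mult_INR, <- !exp_plus, HN. apply exp_le_mono.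
  assert (A := Rle_abs v). assert (B := Rle_abs (- v)). rewrite Rabs_Ropp in B. nra.
Qed.

(** The bound [s <= exp (9/10 (s - 1))] for [s >= 3/2] leaves a decay rate [X / 10]. Half of it
    absorbs the contribution of [v], whence the condition [20 |v| <= X]. *)
Lemma weight_right (X v : R) (N : nat) (s : R) :
  INR N = X + v -> 20 * Rabs v <= X -> 3/2 <= s ->
  weight X N s <= exp (- (X / 20 * (s - 1))).
Proof.
  intros HN HX Hs. unfold weight.
  assert (H1 : s <= exp (9/10 * (s - 1))).
  { replace (9 / 10 * (s - 1)) with (9/20 * (s - 1) + 9/20 * (s - 1)) by field.
    rewrite exp_plus. assert (B := exp_ineq1_le (9/20 * (s - 1))).
    set (e := exp (9/20 * (s - 1))) in *.
    assert ((1 + 9/20 * (s - 1)) * (1 + 9/20 * (s - 1)) <= e * e)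
      by (apply Rmult_le_compat; lra).
    nra. }
  apply Rle_trans with (exp (X * (1 - s)) * exp (9/10 * (s - 1)) ^ N).
  { apply Rmult_le_compat_l; [left; apply exp_pos|]. apply pow_incr; lra. }
  rewrite <- exp_mult_INR, <- exp_plus, HN. apply exp_le_mono.
  assert (A := Rle_abs v). assert (A0 := Rabs_pos v).
  assert (0 <= (s - 1) * (X / 20 - 9/10 * v)) by (apply Rmult_le_pos; lra). lra.
Qed.

Lemma inv_pow_le_2 (x : R) (p : nat) : (p < 2)%nat -> 1/2 <= Rabs x -> Rabs (/ x ^ p) <= 2.
Proof.
  intros Hp Hx. destruct p as [|[|p]]; [| |lia].
  - simpl. rewrite Rinv_1, Rabs_R1. lra.
  - rewrite pow_1, Rabs_inv. replace 2 with (/ (1/2)) by field.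
    apply Rinv_le_contravar; lra.
Qed.

Lemma ex_RInt_weight_div (X : R) (N p : nat) (a b : R) :
  (forall x, Rmin a b <= x <= Rmax a b -> x <> 1) ->
  ex_RInt (fun s => weight X N s / (1 - s) ^ p) a b.
Proof.
  intros H. apply ex_RInt_derivable. intros x Hx. unfold weight. auto_derive.
  apply pow_nonzero. specialize (H x Hx). lra.
Qed.

Lemma tail_left (X v : R) (N p : nat) :
  (p < 2)%nat -> INR N = X + v ->
  Rabs (RInt (fun s => weight X N s / (1 - s) ^ p) 0 (1/2))
  <= exp (2 * Rabs v) * exp (- (X / 10)).
Proof.
  intros Hp HN.
  replace (exp (2 * Rabs v) * exp (- (X / 10)))
    with ((1/2 - 0) * (exp (2 * Rabs v) * exp (- (X / 10)) * 2)) by field.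
  apply abs_RInt_le_const; [lra| |].
  { apply ex_RInt_weight_div. intros x. rewrite Rmin_left, Rmax_right by lra. lra. }
  intros s Hs. unfold Rdiv. rewrite Rabs_mult.
  rewrite Rabs_pos_eq by (apply weight_pos; lra).
  apply Rmult_le_compat; [apply weight_pos; lra|apply Rabs_pos| |].
  - now apply weight_left.
  - apply inv_pow_le_2; [easy|]. rewrite Rabs_pos_eq; lra.
Qed.

(** The dominating exponential has the explicit primitive [G], which is negative, so dropping [G S]
    gives a bound independent of [S]. *)
Lemma tail_right (X v S : R) (N p : nat) :
  (p < 2)%nat -> INR N = X + v -> 1 <= X -> 20 * Rabs v <= X -> 3/2 <= S ->
  Rabs (RInt (fun s => weight X N s / (1 - s) ^ p) (3/2) S) <= 40 * exp (- (X / 40)).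
Proof.
  intros Hp HN HX1 HX HS.
  set (G := fun s => - (40 / X) * exp (- (X / 20 * (s - 1)))).
  assert (HG : is_RInt (fun s => 2 * exp (- (X / 20 * (s - 1)))) (3/2) S (G S - G (3/2))).
  { apply (is_RInt_derive (V := R_CompleteNormedModule)).
    - intros x _. unfold G. auto_derive; [easy|].
      replace (x + - (1)) with (x - 1) by ring. unfold Rdiv. field. lra.
    - intros x _. apply (ex_derive_continuous (K := R_AbsRing) (V := R_NormedModule)).
      auto_derive. easy. }
  apply Rle_trans with (G S - G (3/2)).
  - refine (norm_RInt_le (V := R_NormedModule) _ _ _ _ _ _ HS _ _ HG).
    2: { apply (RInt_correct (V := R_CompleteNormedModule)), ex_RInt_weight_div.
         intros x. rewrite Rmin_left, Rmax_right by lra. lra. }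
    intros s Hs. change (Rabs (weight X N s / (1 - s) ^ p)
      <= 2 * exp (- (X / 20 * (s - 1)))).
    unfold Rdiv at 1. rewrite Rabs_mult, (Rmult_comm 2).
    rewrite Rabs_pos_eq by (apply weight_pos; lra).
    apply Rmult_le_compat; [apply weight_pos; lra|apply Rabs_pos| |].
    + apply weight_right with v; lra.
    + apply inv_pow_le_2; [easy|]. rewrite Rabs_left1; lra.
  - unfold G. replace (X / 20 * (3 / 2 - 1)) with (X / 40) by field.
    assert (HI : 0 < / X <= 1).
    { split; [apply Rinv_0_lt_compat; lra|]. rewrite <- Rinv_1.
      apply Rinv_le_contravar; lra. }
    assert (P1 := exp_pos (- (X / 20 * (S - 1)))). assert (P2 := exp_pos (- (X / 40))).
    unfold Rdiv at 1 3. nra.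
Qed.

Lemma tails_small (v : R) (n p : nat) :
  (p < 2)%nat ->
  exists C, 0 <= C /\ forall X eps S N, 1 <= X -> 20 * Rabs v <= X -> INR N = X + v ->
    small_cut X eps -> 3/2 <= S ->
    Rabs (RInt (fun s => weight X N s / (1 - s) ^ p) 0 (1/2))
    + Rabs (RInt (fun s => weight X N s / (1 - s) ^ p) (3/2) S)
    <= C * (moment X eps 0 / X ^ n).
Proof.
  intros Hp. destruct (pow_le_exp (n + 1) (1/40)) as [D [HD H]]; [lra|].
  set (A := exp (2 * Rabs v) + 40).
  assert (HA : 0 < A) by (assert (h := exp_pos (2 * Rabs v)); unfold A; lra).
  exists (A * (8 * D)); split.
  { apply Rmult_le_pos; lra. }
  intros X eps S N HX HXv HN Hs HS.
  assert (T1 := tail_left X v N p Hp HN).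
  assert (T2 := tail_right X v S N p Hp HN HX HXv HS).
  destruct (moment0_lower X eps HX Hs) as [HM _].
  assert (Hn : 0 < X ^ n) by (apply pow_lt; lra).
  specialize (H X ltac:(lra)).
  apply Rle_trans with (A * exp (- (X / 40))).
  { assert (exp (- (X / 10)) <= exp (- (X / 40))) by (apply exp_le_mono; lra).
    assert (h := exp_pos (2 * Rabs v)). unfold A. nra. }
  rewrite Rmult_assoc. apply Rmult_le_compat_l; [lra|].
  apply Rle_trans with (8 * D * (/ (8 * X) / X ^ n)).
  - assert (E : exp (1/40 * X) * exp (- (X / 40)) = 1)
      by (rewrite <- exp_plus; replace (_ + _) with 0 by field; apply exp_0).
    apply Rmult_le_reg_r with (X ^ n * X); [apply Rmult_lt_0_compat; lra|].
    replace (8 * D * (/ (8 * X) / X ^ n) * (X ^ n * X))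
      with (D * exp (1/40 * X) * exp (- (X / 40)))
      by (rewrite Rmult_assoc, E; field; lra).
    replace (exp (- (X / 40)) * (X ^ n * X))
      with (X ^ (n + 1) * exp (- (X / 40))) by (rewrite !pow_add; simpl; ring).
    apply Rmult_le_compat_r; [left; apply exp_pos|easy].
  - apply Rmult_le_compat_l; [lra|]. unfold Rdiv.
    apply Rmult_le_compat_r; [left; now apply Rinv_0_lt_compat|easy].
Qed.

Lemma weight_central (X v : R) (N : nat) (x : R) :
  INR N = X + v -> 0 < Rabs x <= 1/2 ->
  weight X N (1 + x)
  = exp (- (X * x ^ 2 / 2)) * (exp (X * x ^ 2 * log_tail x) * Rpower (1 + x) v).
Proof.
  intros HN Hx.
  assert (Hx0 : x <> 0) by (intros ->; rewrite Rabs_R0 in Hx; lra).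
  assert (Hx1 : 0 < 1 + x).
  { destruct Hx as [_ Hx]. apply Rabs_le_between in Hx. lra. }
  unfold weight. rewrite <- (Rpower_pow N (1 + x)) by easy.
  unfold Rpower. rewrite <- !exp_plus, HN. f_equal.
  unfold log_tail. field. easy.
Qed.

Lemma cut_integral_asymptotic (v : R) (n p : nat) :
  (p < 2)%nat ->
  exists C, 0 <= C /\ forall X eps S N l1 l2,
    1 <= X -> 20 * Rabs v <= X -> INR N = X + v -> small_cut X eps -> 3/2 <= S ->
    is_RInt (fun s => weight X N s / (1 - s) ^ p) 0 (1 - eps) l1 ->
    is_RInt (fun s => weight X N s / (1 - s) ^ p) (1 + eps) S l2 ->
    Rabs (l1 + l2
          - 2 * moment X eps 0 * rsum n (fun r => laplace_coef v p n r / X ^ r))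
    <= C * (moment X eps 0 / X ^ n).
Proof.
  intros Hp.
  destruct (central_asymptotic v n p Hp) as [C1 [HC1 H1]].
  destruct (tails_small v n p Hp) as [C2 [HC2 H2]].
  exists (C1 + C2); split; [lra|].
  intros X eps S N l1 l2 HX HXv HN Hs HS Hl1 Hl2.
  destruct (small_cut_bounds X eps HX Hs) as [E0 [E1 [E2 E3]]].
  specialize (H2 X eps S N HX HXv HN Hs HS).
  set (k := fun s => weight X N s / (1 - s) ^ p) in *.
  set (f := fun x => weight X N (1 + x)).
  specialize (H1 X eps f HX Hs (fun x Hx => weight_central X v N x HN Hx)).
  set (g := fun x => (f (- x) + (-1) ^ p * f x) / x ^ p) in *.
  assert (Hk1 : ex_RInt k 0 (1/2)).
  { apply ex_RInt_weight_div. intros x. rewrite Rmin_left, Rmax_right by lra. lra. }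
  assert (Hk2 : ex_RInt k (1/2) (1 - eps)).
  { apply ex_RInt_weight_div. intros x. rewrite Rmin_left, Rmax_right by lra. lra. }
  assert (Hk3 : ex_RInt k (1 + eps) (3/2)).
  { apply ex_RInt_weight_div. intros x. rewrite Rmin_left, Rmax_right by lra. lra. }
  assert (Hk4 : ex_RInt k (3/2) S).
  { apply ex_RInt_weight_div. intros x. rewrite Rmin_left, Rmax_right by lra. lra. }
  assert (EL1 := is_RInt_unique (V := R_CompleteNormedModule) _ _ _ _ Hl1).
  assert (EL2 := is_RInt_unique (V := R_CompleteNormedModule) _ _ _ _ Hl2).
  rewrite <- (RInt_Chasles (V := R_CompleteNormedModule) _ _ _ _ Hk1 Hk2) in EL1.
  rewrite <- (RInt_Chasles (V := R_CompleteNormedModule) _ _ _ _ Hk3 Hk4) in EL2.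
  unfold plus in EL1, EL2; simpl in EL1, EL2.
  (* Put [s = 1 - x] on the left and [s = 1 + x] on the right: [(1 - s)^p] becomes [x^p] and
     [(-x)^p], which is the origin of the sign [(-1)^p] in [g]. *)
  assert (Hg : is_RInt g eps (1/2) (RInt k (1/2) (1 - eps) + RInt k (1 + eps) (3/2))).
  { apply (is_RInt_extR (fun x => f (- x) / x ^ p + (-1) ^ p * f x / x ^ p)).
    { intros x _. unfold g, Rdiv. ring. }
    apply (is_RInt_plus (V := R_NormedModule)).
    - assert (L : is_RInt k (-1 * (1/2) + 1) (-1 * eps + 1) (RInt k (1/2) (1 - eps))).
      { replace (-1 * (1/2) + 1) with (1/2) by field.
        replace (-1 * eps + 1) with (1 - eps) by ring.
        now apply (RInt_correct (V := R_CompleteNormedModule)). }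
      apply (is_RInt_comp_lin (V := R_NormedModule)) in L.
      apply (is_RInt_swap (V := R_NormedModule)) in L.
      apply (is_RInt_opp (V := R_NormedModule)) in L.
      rewrite opp_opp in L.
      revert L. apply is_RInt_extR. intros x _.
      unfold scal, opp; simpl; unfold mult; simpl. unfold k, f.
      replace (-1 * x + 1) with (1 + - x) by ring.
      replace (1 - (1 + - x)) with x by ring. ring.
    - assert (L : is_RInt k (1 * eps + 1) (1 * (1/2) + 1) (RInt k (1 + eps) (3/2))).
      { replace (1 * (1/2) + 1) with (3/2) by field.
        replace (1 * eps + 1) with (1 + eps) by ring.
        now apply (RInt_correct (V := R_CompleteNormedModule)). }
      apply (is_RInt_comp_lin (V := R_NormedModule)) in L.
      revert L. apply is_RInt_extR. intros x _.
      unfold scal; simpl; unfold mult; simpl. unfold k, f.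
      replace (1 * x + 1) with (1 + x) by ring.
      replace (1 - (1 + x)) with (-1 * x) by ring.
      rewrite Rpow_mult_distr. unfold Rdiv. rewrite Rinv_mult, <- pow_inv.
      replace (/ -1) with (-1) by field. ring. }
  specialize (H1 (ex_intro _ _ Hg)).
  rewrite (is_RInt_unique (V := R_CompleteNormedModule) _ _ _ _ Hg) in H1.
  rewrite <- EL1, <- EL2.
  set (c1 := RInt k 0 (1/2)) in *. set (c2 := RInt k (1/2) (1 - eps)) in *.
  set (c3 := RInt k (1 + eps) (3/2)) in *. set (c4 := RInt k (3/2) S) in *.
  set (T := 2 * moment X eps 0 * _) in *.
  replace (c1 + c2 + (c3 + c4) - T) with ((c2 + c3 - T) + (c1 + c4)) by ring.
  eapply Rle_trans; [apply Rabs_triang|].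
  assert (HH := Rabs_triang c1 c4). lra.
Qed.

(** * Limits of cut integrals *)

(** One notion for the principal value at 1 and the improper integral at infinity. The threshold
    [S0] may depend on [eps], as it does in [is_Ei], where the integral from minus infinity
    converges for each [eps] separately. Regular integrands are cut at 1 as well, so that they can
    be combined linearly with the singular one. *)
Definition cutlim (f : R -> R) (L : R) : Prop :=
  forall eta, 0 < eta -> exists e0, 0 < e0 /\ forall eps, 0 < eps < e0 ->
    exists S0, forall S, S0 < S -> exists l1 l2,
      is_RInt f 0 (1 - eps) l1 /\ is_RInt f (1 + eps) S l2 /\ Rabs (l1 + l2 - L) < eta.

Lemma cutlim_ext (f g : R -> R) (L : R) :
  (forall s, s <> 1 -> f s = g s) -> cutlim f L -> cutlim g L.
Proof.
  intros E H eta Heta. destruct (H eta Heta) as [e0 [He0 H1]].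
  exists e0; split; [easy|]. intros eps Heps. destruct (H1 eps Heps) as [S0 H2].
  exists (Rmax S0 1). intros S HS.
  destruct (H2 S) as [l1 [l2 [A [B C]]]]; [eapply Rle_lt_trans; [apply Rmax_l|exact HS]|].
  assert (HS1 : 1 < S) by (eapply Rle_lt_trans; [apply Rmax_r|exact HS]).
  exists l1, l2. repeat split; [| |easy].
  - revert A. apply is_RInt_extR. intros x [_ Hx]. apply E.
    assert (Rmax 0 (1 - eps) <= 1) by (apply Rmax_lub; lra). lra.
  - revert B. apply is_RInt_extR. intros x [Hx _]. apply E.
    assert (1 <= Rmin (1 + eps) S) by (apply Rmin_glb; lra). lra.
Qed.

Lemma cutlim_lin (f g : R -> R) (c Lf Lg : R) :
  cutlim f Lf -> cutlim g Lg -> cutlim (fun s => f s + c * g s) (Lf + c * Lg).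
Proof.
  intros Hf Hg eta Heta. assert (Hc := Rabs_pos c).
  set (d := eta / (1 + Rabs c)).
  assert (Hd : 0 < d) by (apply Rdiv_lt_0_compat; lra).
  destruct (Hf d Hd) as [e1 [He1 H1]]. destruct (Hg d Hd) as [e2 [He2 H2]].
  exists (Rmin e1 e2); split; [now apply Rmin_glb_lt|]. intros eps Heps.
  assert (M1 := Rmin_l e1 e2). assert (M2 := Rmin_r e1 e2).
  destruct (H1 eps) as [S1 H1']; [lra|]. destruct (H2 eps) as [S2 H2']; [lra|].
  exists (Rmax S1 S2). intros S HS.
  assert (M3 := Rmax_l S1 S2). assert (M4 := Rmax_r S1 S2).
  destruct (H1' S) as [a1 [a2 [A1 [A2 A3]]]]; [lra|].
  destruct (H2' S) as [b1 [b2 [B1 [B2 B3]]]]; [lra|].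
  exists (a1 + c * b1), (a2 + c * b2). repeat split.
  - apply (is_RInt_plus (V := R_NormedModule)); [easy|].
    now apply (is_RInt_scal (V := R_NormedModule)).
  - apply (is_RInt_plus (V := R_NormedModule)); [easy|].
    now apply (is_RInt_scal (V := R_NormedModule)).
  - replace (a1 + c * b1 + (a2 + c * b2) - (Lf + c * Lg))
      with ((a1 + a2 - Lf) + c * (b1 + b2 - Lg)) by ring.
    eapply Rle_lt_trans; [apply Rabs_triang|]. rewrite Rabs_mult.
    replace eta with (d + Rabs c * d) by (unfold d; field; lra).
    apply Rplus_lt_le_compat; [easy|]. apply Rmult_le_compat_l; lra.
Qed.

(** The cut integrals add up to [G S - G (1 + eps) + G (1 - eps) - G 0]; continuity of [G] at 1
    closes the gap and [G S] tends to 0. *)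
Lemma cutlim_derive (G dG : R -> R) :
  (forall s, is_derive G s (dG s)) -> (forall s, continuous dG s) ->
  (forall eta, 0 < eta -> exists S0, forall S, S0 < S -> Rabs (G S) < eta) ->
  cutlim dG (- G 0).
Proof.
  intros HG HdG Hlim eta Heta.
  assert (Hc : continuity_pt G 1).
  { apply derivable_continuous_pt. exists (dG 1). apply is_derive_Reals, HG. }
  destruct (Hc (eta / 3)) as [e0 [He0 H]]; [lra|].
  assert (Hn : forall x, Rabs (x - 1) < e0 -> Rabs (G x - G 1) < eta / 3).
  { intros x Hx. destruct (Req_dec x 1) as [->|Hx1].
    - rewrite Rminus_diag, Rabs_R0. lra.
    - apply (H x). split; [split; [easy|]|exact Hx]. now apply not_eq_sym. }
  exists e0; split; [easy|]. intros eps Heps.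
  destruct (Hlim (eta / 3)) as [S0 HS0]; [lra|]. exists S0. intros S HS.
  exists (G (1 - eps) - G 0), (G S - G (1 + eps)). repeat split.
  - now apply (is_RInt_derive (V := R_CompleteNormedModule)).
  - now apply (is_RInt_derive (V := R_CompleteNormedModule)).
  - specialize (HS0 S HS).
    assert (N1 := Hn (1 - eps)). assert (N2 := Hn (1 + eps)).
    replace (1 - eps - 1) with (- eps) in N1 by ring. rewrite Rabs_Ropp in N1.
    replace (1 + eps - 1) with eps in N2 by ring.
    rewrite (Rabs_pos_eq eps) in N1, N2 by lra.
    specialize (N1 (proj2 Heps)). specialize (N2 (proj2 Heps)).
    apply Rabs_def2 in N1, N2, HS0. apply Rabs_def1; lra.
Qed.

Lemma pow_exp_vanishes (X : R) (j : nat) :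
  0 < X -> forall eta, 0 < eta -> exists S0, forall S, S0 < S ->
    Rabs (- (exp (- (X * S)) * S ^ j)) < eta.
Proof.
  intros HX eta Heta. destruct (pow_le_exp (S j) X HX) as [C [HC H]].
  exists (Rmax 0 (C / eta)). intros s Hs.
  assert (M1 := Rmax_l 0 (C / eta)). assert (M2 := Rmax_r 0 (C / eta)).
  assert (Hs0 : 0 < s) by lra. specialize (H s ltac:(lra)).
  assert (He := exp_pos (- (X * s))). assert (Hj : 0 < s ^ j) by now apply pow_lt.
  rewrite Rabs_Ropp, Rabs_pos_eq by (apply Rmult_le_pos; lra).
  apply Rmult_lt_reg_l with s; [easy|].
  assert (C < s * eta).
  { apply Rmult_lt_reg_r with (/ eta); [now apply Rinv_0_lt_compat|].
    replace (s * eta * / eta) with s by (field; lra).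
    change (C * / eta) with (C / eta). lra. }
  eapply Rle_lt_trans; [|exact H0].
  replace (s * (exp (- (X * s)) * s ^ j)) with (s ^ S j * exp (- (X * s))) by (simpl; ring).
  apply Rle_trans with (C * exp (X * s) * exp (- (X * s))).
  - apply Rmult_le_compat_r; lra.
  - rewrite Rmult_assoc, <- exp_plus, Rplus_opp_r, exp_0. lra.
Qed.

(** Euler's integral for the factorial, by parts. It provides both the terms to be subtracted from
    the integral of [Ei] and, for [k = N], the denominator of the quotient. *)
Lemma cutlim_gamma (X : R) (k : nat) :
  0 < X -> cutlim (fun s => X * exp (- (X * s)) * s ^ k) (INR (fact k) / X ^ k).
Proof.
  intros HX. induction k as [|k IH].
  - assert (H : cutlim (fun s => X * exp (- (X * s))) (- (- (exp (- (X * 0)) * 0 ^ 0)))).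
    { apply (cutlim_derive (fun s => - (exp (- (X * s)) * s ^ 0))).
      - intros s. auto_derive; [easy|]. simpl. ring.
      - intros s. apply (ex_derive_continuous (K := R_AbsRing) (V := R_NormedModule)).
        auto_derive. easy.
      - now apply pow_exp_vanishes. }
    replace (INR (fact 0) / X ^ 0) with (- (- (exp (- (X * 0)) * 0 ^ 0))).
    + revert H. apply cutlim_ext. intros s _. simpl. ring.
    + rewrite Rmult_0_r, Ropp_0, exp_0. simpl. field.
  - set (G := fun s => - (exp (- (X * s)) * s ^ S k)).
    assert (H : cutlim (fun s => X * exp (- (X * s)) * s ^ S k
                          - INR (S k) * (exp (- (X * s)) * s ^ k)) (- G 0)).
    { apply (cutlim_derive G).
      - intros s. unfold G. auto_derive; [easy|].
        change (match k with O => 1 | S _ => INR k + 1 end) with (INR (S k)).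
        generalize (INR (S k)). intros. simpl. ring.
      - intros s. apply (ex_derive_continuous (K := R_AbsRing) (V := R_NormedModule)).
        auto_derive. easy.
      - now apply pow_exp_vanishes. }
    assert (H' := cutlim_lin _ _ (INR (S k) / X) _ _ H IH).
    replace (INR (fact (S k)) / X ^ S k)
      with (- G 0 + INR (S k) / X * (INR (fact k) / X ^ k)).
    + revert H'. apply cutlim_ext. intros s _. field. lra.
    + unfold G. replace (INR (fact (S k))) with (INR (S k) * INR (fact k))
        by (rewrite <- mult_INR; easy).
      simpl pow. field. split; [apply pow_nonzero|]; lra.
Qed.

Lemma cutlim_rsum (f : nat -> R -> R) (L : nat -> R) (n : nat) :
  (forall k, cutlim (f k) (L k)) ->
  cutlim (fun s => rsum n (fun k => f k s)) (rsum n L).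
Proof.
  intros H. induction n as [|n IH].
  { assert (H0 : cutlim (fun _ => 0) (- (fun _ : R => 0) 0)).
    { apply (cutlim_derive (fun _ => 0) (fun _ => 0)).
      - intros s. apply (is_derive_const (K := R_AbsRing) (V := R_NormedModule)).
      - intros s. apply continuous_const.
      - intros eta Heta. exists 0. intros. now rewrite Rabs_R0. }
    cbv beta in H0. now rewrite Ropp_0 in H0. }
  assert (H' := cutlim_lin _ _ 1 _ _ IH (H n)).
  simpl. rewrite Rmult_1_l in H'.
  revert H'. apply cutlim_ext. intros; ring.
Qed.

(* The substitution [t = X (1 - s)]. *)
Lemma cutlim_Ei (X L : R) :
  0 < X -> is_Ei X L ->
  cutlim (fun s => X * exp (- (X * s)) / (1 - s)) (X * exp (- X) * L).
Proof.
  intros HX [I [HI Hlim]] eta Heta.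
  set (c := X * exp (- X)).
  assert (Hc : 0 < c) by (apply Rmult_lt_0_compat; [easy|apply exp_pos]).
  set (d := eta / (2 * c)).
  assert (Hd : 0 < d) by (apply Rdiv_lt_0_compat; lra).
  assert (Hsubst : forall a b l, (forall y, Rmin a b < y < Rmax a b -> y <> 1) ->
    is_RInt Ei_integrand (X * (1 - b)) (X * (1 - a)) l ->
    is_RInt (fun s => X * exp (- (X * s)) / (1 - s)) a b (c * l)).
  { intros a b l Hab H.
    replace (X * (1 - b)) with (- X * b + X) in H by ring.
    replace (X * (1 - a)) with (- X * a + X) in H by ring.
    apply (is_RInt_swap (V := R_NormedModule)) in H.
    apply (is_RInt_comp_lin (V := R_NormedModule)) in H.
    apply (is_RInt_scal (V := R_NormedModule) _ _ _ (- c)) in H.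
    replace (c * l) with (scal (- c) (opp l))
      by (unfold scal, opp; simpl; unfold mult; simpl; ring).
    revert H. apply is_RInt_extR. intros y Hy.
    unfold scal; simpl; unfold mult; simpl. unfold Ei_integrand, c.
    assert (Hy1 := Hab y Hy).
    replace (- X * y + X) with (X + - (X * y)) by ring. rewrite exp_plus, exp_Ropp.
    assert (He := exp_pos X). field. repeat split; try lra.
    replace (X + - (X * y)) with (X * (1 - y)) by ring.
    apply Rmult_integral_contrapositive; split; lra. }
  assert (Hball : locally L (fun z => Rabs (z - L) < d)).
  { exists (mkposreal d Hd). intros z Hz. exact Hz. }
  destruct (Hlim _ Hball) as [e1 He1].
  exists (Rmin 1 (e1 / X)). assert (He1p := cond_pos e1).
  assert (He1X : 0 < e1 / X) by now apply Rdiv_lt_0_compat.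
  split; [apply Rmin_glb_lt; lra|]. intros eps Heps.
  assert (M1 := Rmin_l 1 (e1 / X)). assert (M2 := Rmin_r 1 (e1 / X)).
  assert (HXe : 0 < X * eps) by (apply Rmult_lt_0_compat; lra).
  assert (HXe1 : X * eps < e1).
  { apply Rmult_lt_reg_r with (/ X); [now apply Rinv_0_lt_compat|].
    replace (X * eps * / X) with eps by (field; lra). change (e1 * / X) with (e1 / X). lra. }
  assert (HB : Rabs (I (X * eps) + RInt Ei_integrand (X * eps) X - L) < d).
  { apply He1; [|easy]. change (Rabs (X * eps - 0) < e1).
    rewrite Rminus_0_r, Rabs_pos_eq; lra. }
  assert (Hball2 : locally (I (X * eps)) (fun z => Rabs (z - I (X * eps)) < d)).
  { exists (mkposreal d Hd). intros z Hz. exact Hz. }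
  destruct (HI (X * eps) HXe _ Hball2) as [Q P [M HM] HP Himp].
  (* The upper end [S] corresponds to [t = X (1 - S)], which falls below the threshold [M] once
     [S > 1 - M / X]. *)
  exists (Rmax 1 (1 - M / X)). intros S HS.
  assert (M3 := Rmax_l 1 (1 - M / X)). assert (M4 := Rmax_r 1 (1 - M / X)).
  assert (HSM : X * (1 - S) < M).
  { apply Rmult_lt_reg_r with (/ X); [now apply Rinv_0_lt_compat|].
    replace (X * (1 - S) * / X) with (1 - S) by (field; lra).
    change (M * / X) with (M / X). lra. }
  destruct (Himp (X * (1 - S)) (- (X * eps)) (HM _ HSM) HP) as [z [Hz1 Hz2]].
  simpl in Hz1.
  exists (c * RInt Ei_integrand (X * eps) X), (c * z). repeat split.
  - apply Hsubst.
    { intros y [_ Hy]. assert (Rmax 0 (1 - eps) <= 1) by (apply Rmax_lub; lra). lra. }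
    replace (X * (1 - (1 - eps))) with (X * eps) by ring.
    replace (X * (1 - 0)) with X by ring.
    apply (RInt_correct (V := R_CompleteNormedModule)).
    apply ex_RInt_derivable. intros x [Hx _]. unfold Ei_integrand. auto_derive.
    assert (0 < Rmin (X * eps) X) by (apply Rmin_glb_lt; lra). lra.
  - apply Hsubst.
    { intros y [Hy _]. assert (1 <= Rmin (1 + eps) S) by (apply Rmin_glb; lra). lra. }
    replace (X * (1 - (1 + eps))) with (- (X * eps)) by ring. exact Hz1.
  - replace (c * RInt Ei_integrand (X * eps) X + c * z - c * L)
      with (c * ((I (X * eps) + RInt Ei_integrand (X * eps) X - L) + (z - I (X * eps))))
      by ring.
    rewrite Rabs_mult, (Rabs_pos_eq c) by lra.
    replace eta with (c * (d + d)) by (unfold d; field; lra).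
    apply Rmult_lt_compat_l; [easy|].
    eapply Rle_lt_trans; [apply Rabs_triang|]. lra.
Qed.

(** Numerator and denominator must share the same [eps]: both are measured against [moment X eps 0],
    which cancels only if it is the same number. *)
Lemma cutlim_pair (f g : R -> R) (Lf Lg eta e1 S1 : R) :
  cutlim f Lf -> cutlim g Lg -> 0 < eta -> 0 < e1 ->
  exists eps S a1 a2 b1 b2, 0 < eps <= e1 /\ S1 <= S /\
    is_RInt f 0 (1 - eps) a1 /\ is_RInt f (1 + eps) S a2 /\ Rabs (a1 + a2 - Lf) < eta /\
    is_RInt g 0 (1 - eps) b1 /\ is_RInt g (1 + eps) S b2 /\ Rabs (b1 + b2 - Lg) < eta.
Proof.
  intros Hf Hg Heta He1.
  destruct (Hf eta Heta) as [ef [Hef H1]]. destruct (Hg eta Heta) as [eg [Heg H2]].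
  set (eps := Rmin e1 (Rmin ef eg / 2)).
  assert (M1 := Rmin_l ef eg). assert (M2 := Rmin_r ef eg).
  assert (M0 : 0 < Rmin ef eg) by now apply Rmin_glb_lt.
  assert (M3 : eps <= e1) by apply Rmin_l.
  assert (M4 : eps <= Rmin ef eg / 2) by apply Rmin_r.
  assert (M5 : 0 < eps) by (apply Rmin_glb_lt; lra).
  destruct (H1 eps) as [Sf H1']; [lra|]. destruct (H2 eps) as [Sg H2']; [lra|].
  set (S := Rmax S1 (Rmax Sf Sg) + 1).
  assert (N1 := Rmax_l Sf Sg). assert (N2 := Rmax_r Sf Sg).
  assert (N3 := Rmax_l S1 (Rmax Sf Sg)). assert (N4 := Rmax_r S1 (Rmax Sf Sg)).
  destruct (H1' S) as [a1 [a2 [A1 [A2 A3]]]]; [unfold S; lra|].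
  destruct (H2' S) as [b1 [b2 [B1 [B2 B3]]]]; [unfold S; lra|].
  exists eps, S, a1, a2, b1, b2. repeat split; try easy. unfold S; lra.
Qed.

(** * The remainder as a quotient of cut integrals *)

Lemma geometric_remainder (s : R) (N : nat) :
  s <> 1 -> / (1 - s) - rsum N (pow s) = s ^ N / (1 - s).
Proof.
  intros Hs. induction N as [|N IH]; simpl; [field; lra|].
  unfold Rminus in *. rewrite Ropp_plus_distr, <- Rplus_assoc, IH. field. lra.
Qed.

Lemma cutlim_remainder (X E P : R) (N : nat) :
  0 < X -> is_Ei X E ->
  rsum N (fun k => INR (fact k) / X ^ k) + INR (fact N) / X ^ N * P = X * exp (- X) * E ->
  cutlim (fun s => X * exp (- (X * s)) * s ^ N / (1 - s)) (INR (fact N) / X ^ N * P).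
Proof.
  intros HX HE HP.
  assert (H := cutlim_lin _ _ (-1) _ _ (cutlim_Ei X E HX HE)
     (cutlim_rsum (fun k s => X * exp (- (X * s)) * s ^ k) _ N
       (fun k => cutlim_gamma X k HX))).
  replace (INR (fact N) / X ^ N * P)
    with (X * exp (- X) * E + -1 * rsum N (fun k => INR (fact k) / X ^ k)) by lra.
  revert H. apply cutlim_ext. intros s Hs.
  rewrite rsum_scal.
  transitivity (X * exp (- (X * s)) * (/ (1 - s) - rsum N (pow s)));
    [unfold Rdiv; ring|].
  rewrite geometric_remainder by easy. unfold Rdiv. ring.
Qed.

(* [d] is the normalised denominator [e^X N! / (2 M X^(N+1))], where [M] is the truncated
   Gaussian integral. *)
Lemma remainder_ratio (v : R) (n : nat) :
  exists C, 0 <= C /\ forall X N E P,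
    1 <= X -> 20 * Rabs v <= X -> INR N = X + v -> is_Ei X E ->
    rsum N (fun k => INR (fact k) / X ^ k) + INR (fact N) / X ^ N * P = X * exp (- X) * E ->
    exists d,
      Rabs (d - rsum n (fun r => gamma_r r v / X ^ r)) <= C / X ^ n /\
      Rabs (d * P - rsum n (fun r => tau_r r v / X ^ r)) <= C / X ^ n.
Proof.
  destruct (cut_integral_asymptotic v n 0) as [C0 [HC0 H0]]; [lia|].
  destruct (cut_integral_asymptotic v n 1) as [C1 [HC1 H1]]; [lia|].
  exists (C0 + C1 + 1); split; [lra|]. intros X N E P HX HXv HN HE HP.
  set (w := exp X / X). set (a := INR (fact N) / X ^ N).
  assert (Hw : 0 < w) by (apply Rdiv_lt_0_compat; [apply exp_pos|lra]).
  assert (HXn : 0 < X ^ n) by (apply pow_lt; lra).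
  assert (H8 : 0 < / (8 * X) / X ^ n)
    by (apply Rdiv_lt_0_compat; [apply Rinv_0_lt_compat; lra|easy]).
  (* The tolerance has to be chosen before [eps], so the bound [/ (8 * X)] stands in for the moment.
     After scaling by [w], which turns the integrands into [weight], the distance to the limit is at
     most [M / X^n]; this is the [+ 1] in the constant. *)
  destruct (cutlim_pair _ _ _ _ (/ (8 * X) / X ^ n / w) (exp (- (X / 8)) / (4 * X)) (3/2)
     (cutlim_gamma X N ltac:(lra)) (cutlim_remainder X E P N ltac:(lra) HE HP))
    as [eps [S [a1 [a2 [b1 [b2 [Hs [HS [A1 [A2 [A3 [B1 [B2 B3]]]]]]]]]]]]].
  { now apply Rdiv_lt_0_compat. }
  { apply Rdiv_lt_0_compat; [apply exp_pos|lra]. }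
  fold a in A3, B3.
  assert (Hww : forall s, w * (X * exp (- (X * s))) = exp (X * (1 - s))).
  { intros s. replace (X * (1 - s)) with (X + - (X * s)) by ring.
    rewrite exp_plus. unfold w. field. lra. }
  assert (W0 : forall x y l, is_RInt (fun s => X * exp (- (X * s)) * s ^ N) x y l ->
    is_RInt (fun s => weight X N s / (1 - s) ^ 0) x y (w * l)).
  { intros x y l Hl. apply (is_RInt_scal (V := R_NormedModule) _ _ _ w) in Hl.
    revert Hl. apply is_RInt_extR. intros s _.
    change (w * (X * exp (- (X * s)) * s ^ N) = weight X N s / (1 - s) ^ 0).
    unfold weight. rewrite <- Hww. simpl. field. }
  assert (W1 : forall x y l, is_RInt (fun s => X * exp (- (X * s)) * s ^ N / (1 - s)) x y l ->
    is_RInt (fun s => weight X N s / (1 - s) ^ 1) x y (w * l)).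
  { intros x y l Hl. apply (is_RInt_scal (V := R_NormedModule) _ _ _ w) in Hl.
    revert Hl. apply is_RInt_extR. intros s _.
    change (w * (X * exp (- (X * s)) * s ^ N / (1 - s)) = weight X N s / (1 - s) ^ 1).
    rewrite pow_1. unfold weight. rewrite <- Hww. unfold Rdiv. ring. }
  specialize (H0 X eps S N _ _ HX HXv HN Hs HS (W0 _ _ _ A1) (W0 _ _ _ A2)).
  specialize (H1 X eps S N _ _ HX HXv HN Hs HS (W1 _ _ _ B1) (W1 _ _ _ B2)).
  rewrite (rsum_ext n _ (fun r => gamma_r r v / X ^ r)) in H0
    by (intros; now rewrite laplace_coef_gamma).
  rewrite (rsum_ext n _ (fun r => tau_r r v / X ^ r)) in H1
    by (intros; now rewrite laplace_coef_tau).
  destruct (moment0_lower X eps HX Hs) as [HM _].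
  set (M := moment X eps 0) in *.
  assert (HM0 : 0 < M).
  { eapply Rlt_le_trans; [|exact HM]. apply Rinv_0_lt_compat; lra. }
  exists (w * a / (2 * M)).
  assert (Hfin : forall C l1 l2 L T, C <= C0 + C1 ->
    Rabs (w * l1 + w * l2 - 2 * M * T) <= C * (M / X ^ n) ->
    Rabs (l1 + l2 - L) < / (8 * X) / X ^ n / w ->
    Rabs (w * L / (2 * M) - T) <= (C0 + C1 + 1) / X ^ n).
  { intros C l1 l2 L T HC K1 K2.
    assert (K3 : Rabs (w * l1 + w * l2 - w * L) <= M / X ^ n).
    { replace (w * l1 + w * l2 - w * L) with (w * (l1 + l2 - L)) by ring.
      rewrite Rabs_mult, (Rabs_pos_eq w) by lra.
      apply Rle_trans with (/ (8 * X) / X ^ n).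
      - left. replace (/ (8 * X) / X ^ n) with (w * (/ (8 * X) / X ^ n / w)) by (field; lra).
        now apply Rmult_lt_compat_l.
      - apply Rmult_le_compat_r; [left; now apply Rinv_0_lt_compat|easy]. }
    replace (w * L / (2 * M) - T)
      with (((w * l1 + w * l2 - 2 * M * T) - (w * l1 + w * l2 - w * L)) * / (2 * M))
      by (field; lra).
    assert (HMi : 0 < / (2 * M)) by (apply Rinv_0_lt_compat; lra).
    assert (HMX : 0 < M / X ^ n) by now apply Rdiv_lt_0_compat.
    rewrite Rabs_mult, (Rabs_pos_eq (/ (2 * M))) by lra.
    apply Rle_trans with ((2 * (C0 + C1 + 1) * (M / X ^ n)) * / (2 * M)).
    - apply Rmult_le_compat_r; [lra|].
      unfold Rminus at 1. eapply Rle_trans; [apply Rabs_triang|]. rewrite Rabs_Ropp.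
      nra.
    - right. field. lra. }
  split.
  - now apply (Hfin C0 a1 a2); [lra| |].
  - replace (w * a / (2 * M) * P) with (w * (a * P) / (2 * M)) by (field; lra).
    now apply (Hfin C1 b1 b2); [lra| |].
Qed.

(** * Division of asymptotic series *)

Lemma taylor_at_le (J K : nat) (f : R -> R) (a : nat -> R) :
  (J <= K)%nat -> taylor_at K f a -> taylor_at J f a.
Proof. intros H; induction H as [|K H IH]; [easy|]. intros; now apply IH, taylor_at_pred. Qed.

Lemma poly_bounded (n : nat) (a : nat -> R) :
  exists C, 0 <= C /\ forall x, 0 < Rabs x <= 1/2 -> Rabs (rsum n (fun i => a i * x ^ i)) <= C.
Proof.
  destruct (taylor_at_le 0 n _ a ltac:(lia) (taylor_at_poly n a)) as [C [HC H]].
  exists C; split; [easy|]. intros x Hx. specialize (H x Hx). simpl in H.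
  now rewrite Rminus_0_r, Rmult_1_r in H.
Qed.

(** Here [x] stands for [1 / X]. The inverse of the series [g] is the geometric series in its De
    Moivre polynomials, and all products are compared up to [O(x^n)]. A bound on [P] has to come
    first, as the error terms contain [P]; it follows from [d >= 1/2]. *)
Lemma asymptotic_division (g t : nat -> R) (n : nat) (C : R) :
  g 0%nat = 1 -> (1 <= n)%nat -> 0 <= C ->
  exists D x0, 0 < x0 /\ forall x d P, 0 < x <= x0 ->
    Rabs (d - rsum n (fun r => g r * x ^ r)) <= C * x ^ n ->
    Rabs (d * P - rsum n (fun r => t r * x ^ r)) <= C * x ^ n ->
    Rabs (P - rsum n (fun r =>
       conv (fun m => rsum (S m) (fun k => (-1) ^ k * deMoivre g m k)) t r * x ^ r))
    <= D * x ^ n.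
Proof.
  intros Hg Hn HC.
  set (b := fun m => rsum (S m) (fun k => (-1) ^ k * deMoivre g m k)).
  destruct (taylor_at_mult n _ _ _ _ (taylor_at_poly n g) (taylor_at_poly n b))
    as [K1 [HK1 H1]].
  destruct (taylor_at_mult n _ _ _ _ (taylor_at_poly n b) (taylor_at_poly n t))
    as [K2 [HK2 H2]].
  destruct (poly_bounded n b) as [Kb [HKb Hb]].
  destruct (poly_bounded n t) as [Kt [HKt Ht]].
  destruct (taylor_at_le 1 n _ g Hn (taylor_at_poly n g)) as [Kg [HKg HG]].
  set (Kp := 2 * (Kt + C)).
  (* This [x0] gives [x <= 1/2] and [(Kg + C) x <= 1/2], so that [d] differs from [g 0 = 1] by at
     most [1/2]. *)
  exists (Kp * K1 + Kp * Kb * C + Kb * C + K2), (/ (2 * (Kg + C + 1))).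
  assert (Hi : / (2 * (Kg + C + 1)) <= 1/2).
  { replace (1/2) with (/ 2) by field. apply Rinv_le_contravar; lra. }
  split; [apply Rinv_0_lt_compat; lra|]. intros x d P Hx Hd HP.
  assert (Hxa : 0 < Rabs x <= 1/2) by (rewrite Rabs_pos_eq; lra).
  specialize (H1 x Hxa); specialize (H2 x Hxa); specialize (Hb x Hxa).
  specialize (Ht x Hxa); specialize (HG x Hxa).
  rewrite (Rabs_pos_eq x) in H1, H2, HG by lra.
  rewrite (rsum_ext n (fun i => conv g b i * x ^ i)
             (fun i => (if Nat.eqb i 0 then 1 else 0) * x ^ i)) in H1
    by (intros; unfold b; now rewrite conv_geometric_inverse).
  replace (rsum n (fun i => (if Nat.eqb i 0 then 1 else 0) * x ^ i)) with 1 in H1.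
  2: { destruct n as [|n]; [lia|]. rewrite rsum_recl, rsum_zero by (intros; simpl; ring).
       simpl. ring. }
  replace (rsum 1 (fun i => g i * x ^ i)) with 1 in HG by (simpl; rewrite Hg; ring).
  rewrite pow_1 in HG.
  set (G := rsum n (fun i => g i * x ^ i)) in *.
  set (B := rsum n (fun i => b i * x ^ i)) in *.
  set (T := rsum n (fun i => t i * x ^ i)) in *.
  set (Q := rsum n (fun i => conv b t i * x ^ i)) in *.
  assert (Hxn : 0 < x ^ n <= x).
  { split; [apply pow_lt; lra|]. destruct n as [|n]; [lia|]. simpl.
    rewrite <- (Rmult_1_r x) at 3. apply Rmult_le_compat_l; [lra|]. apply pow_le_1; lra. }
  assert (Hsmall : (Kg + C) * x <= 1/2).
  { apply Rle_trans with ((Kg + C + 1) * / (2 * (Kg + C + 1))).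
    - apply Rmult_le_compat; lra.
    - right. field. lra. }
  assert (Hd2 : 1/2 <= d).
  { assert (C * x ^ n <= C * x) by (apply Rmult_le_compat_l; lra).
    apply Rabs_le_between in Hd, HG. lra. }
  assert (HPb : Rabs P <= Kp).
  { assert (HdP : Rabs (d * P) <= Kt + C).
    { replace (d * P) with ((d * P - T) + T) by ring.
      eapply Rle_trans; [apply Rabs_triang|].
      assert (C * x ^ n <= C * 1) by (apply Rmult_le_compat_l; lra). lra. }
    rewrite Rabs_mult, (Rabs_pos_eq d) in HdP by lra.
    assert (HP0 := Rabs_pos P). unfold Kp. nra. }
  (* Four errors, one for each summand of [D]: [B] inverts [G] only up to [x^n], [d] is not exactly
     [G], [d P] is not exactly [T], and [Q] truncates the product [B T]. *)
  replace (P - Q) with (P * (- (G * B - 1)) + P * B * (- (d - G)) + B * (d * P - T) + (B * T - Q))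
    by ring.
  assert (Hprod : forall y z Y Z, Rabs y <= Y -> Rabs z <= Z -> Rabs (y * z) <= Y * Z).
  { intros. rewrite Rabs_mult. apply Rmult_le_compat; auto using Rabs_pos. }
  rewrite !Rmult_plus_distr_r.
  eapply Rle_trans; [apply Rabs_triang|]. apply Rplus_le_compat; [|exact H2].
  eapply Rle_trans; [apply Rabs_triang|]. apply Rplus_le_compat.
  2: { rewrite Rmult_assoc. now apply Hprod. }
  eapply Rle_trans; [apply Rabs_triang|]. apply Rplus_le_compat.
  - rewrite Rmult_assoc. apply Hprod; [easy|]. now rewrite Rabs_Ropp.
  - rewrite (Rmult_assoc (Kp * Kb)). apply Hprod; [now apply Hprod|]. now rewrite Rabs_Ropp.
Qed.

Theorem theorem8p1 (v : Z) (EiN : nat -> R) (Psi : nat -> R)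
  (HEi : forall n : nat, (1 <= n)%nat -> is_Ei (INR n) (EiN n))
  (HPsi : forall n : nat, (1 <= n)%nat -> (0 <= Z.of_nat n + v)%Z ->
     let N := Z.to_nat (Z.of_nat n + v) in
     rsum N (fun k => INR (fact k) / INR n ^ k)
       + INR (fact N) / INR n ^ N * Psi n
     = INR n * exp (- INR n) * EiN n)
  (R0 : nat) (HR : (1 <= R0)%nat) :
  exists C : R, exists N0 : nat,
    forall n : nat, (N0 <= n)%nat -> (1 <= n)%nat -> (0 <= Z.of_nat n + v)%Z ->
      Rabs (Psi n - rsum R0 (fun r => psi_r r (IZR v) / INR n ^ r))
        <= C / INR n ^ R0.
Proof.
  destruct (remainder_ratio (IZR v) R0) as [C [HC H]].
  destruct (asymptotic_division (fun r => gamma_r r (IZR v)) (fun r => tau_r r (IZR v)) R0 C)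
    as [D [x0 [Hx0 HD]]]; [|easy|easy|].
  (* [gamma_0 (v) = 1], where [(-1)!! = 1] enters; this makes the series of the denominator
     invertible. *)
  { unfold gamma_r, inner_sum, gbinom, dfactZ. simpl. field. }
  (* From [N0] on, [n] meets both requirements: [20 |v| <= n] for the tails and [1 / n <= x0] for
     the division. *)
  destruct (INR_unbounded (Rmax (20 * Rabs (IZR v)) (/ x0))) as [N0 HN0].
  assert (M1 := Rmax_l (20 * Rabs (IZR v)) (/ x0)).
  assert (M2 := Rmax_r (20 * Rabs (IZR v)) (/ x0)).
  exists D, N0. intros n Hn Hn1 Hnv.
  apply le_INR in Hn. assert (Hn1' := le_INR _ _ Hn1). simpl (INR 1) in Hn1'.
  destruct (H (INR n) (Z.to_nat (Z.of_nat n + v)) (EiN n) (Psi n)) as [d [Hd1 Hd2]];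
    [easy|lra| |auto|now apply HPsi|].
  { rewrite INR_IZR_INZ, Z2Nat.id, plus_IZR, <- INR_IZR_INZ; easy. }
  assert (Hx : 0 < / INR n <= x0).
  { split; [apply Rinv_0_lt_compat; lra|]. rewrite <- (Rinv_inv x0).
    apply Rinv_le_contravar; [now apply Rinv_0_lt_compat|lra]. }
  assert (Hdiv : forall a, rsum R0 (fun r => a r / INR n ^ r)
                           = rsum R0 (fun r => a r * (/ INR n) ^ r)).
  { intros a. apply rsum_ext; intros r _. now rewrite pow_inv. }
  rewrite Hdiv in Hd1, Hd2 |- *. unfold Rdiv in Hd1, Hd2 |- *.
  rewrite <- pow_inv in Hd1, Hd2 |- *.
  eapply Rle_trans; [|exact (HD _ _ _ Hx Hd1 Hd2)]. right. do 2 f_equal.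
  apply rsum_ext; intros r _. f_equal. apply rsum_ext; intros m _. ring.
Qed.
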